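(* Consider the two-timescale delay-optimal control problem $\min_\pi J_\pi^{(\boldsymbol\beta,\boldsymbol\gamma)}(\boldsymbol\chi(1))$ defined in the context. Its optimal control policy can be obtained by solving the following equivalent Bellman equation with respect to $(\theta,\{V(\mathbf E,\mathbf Q)\})$: $$\theta+V(\mathbf E,\mathbf Q)=\min_{\Omega(\mathbf E,\mathbf Q)}\Big\{g\big((\mathbf E,\mathbf Q),\Omega(\mathbf E,\mathbf Q)\big)+\sum_{(\mathbf E',\mathbf Q')}\Pr[(\mathbf E',\mathbf Q')|(\mathbf E,\mathbf Q),\Omega(\mathbf E,\mathbf Q)]\,V(\mathbf E',\mathbf Q')\Big\}\quad\forall(\mathbf E,\mathbf Q)\in\boldsymbol{\mathcal E}\times\boldsymbol{\mathcal Q},$$ where $\Omega(\mathbf E,\mathbf Q)$ ranges over partitioned actions (see context), $g((\mathbf E,\mathbf Q),\Omega(\mathbf E,\mathbf Q))=\sum_{k\in\mathcal K}\beta_kf(Q_k)+\sum_{b\in\mathcal B}\gamma_b\,\Omega_{p,b}(\mathbf E,\mathbf Q)\,\mathbf I[E_b=0]$ is the per-stage cost, and $\Pr[(\mathbf E',\mathbf Q')|(\mathbf E,\mathbf Q),\Omega(\mathbf E,\mathbf Q)]=\mathbb E\big[\Pr[(\mathbf E',\mathbf Q')|\boldsymbol\chi,\Omega(\boldsymbol\chi)]\,\big|\,(\mathbf E,\mathbf Q)\big]$ is the transition kernel. Here $\theta$ is the optimal value for all initial states, i.e. $\theta=\min_\pi J_\pi^{(\boldsymbol\beta,\boldsymbol\gamma)}(\boldsymbol\chi)$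 for all $\boldsymbol\chi\in\boldsymbol{\mathcal X}$. Furthermore, if $\Omega^*(\mathbf E,\mathbf Q)=(\Omega_p^*(\mathbf E,\mathbf Q),\Omega_s^*(\mathbf E,\mathbf Q))$ attains the minimum on the right-hand side for all $(\mathbf E,\mathbf Q)\in\boldsymbol{\mathcal E}\times\boldsymbol{\mathcal Q}$, then the stationary policy $\Omega^*=(\Omega_p^*,\Omega_s^* )$ is optimal, i.e. $\pi^*=\{\Omega^*,\Omega^*,\dots\}$.
   Context: **System.** There are $B$ base stations (BSs), each with $N_t$ antennas, and $K$ single-antenna mobile stations (MSs). $\mathcal B=\{1,\dots,B\}$ is partitioned into $N=B/N_t$ clusters $\mathcal B_1,\dots,\mathcal B_N$ of $N_t$ BSs each. The set $\mathcal K$ of MSs is the disjoint union of the sets $\mathcal K_b$ (MSs associated with BS $b$). Time is slotted, $t=1,2,\dots$. The fading vector from BS $b$ to MS $k$ in slot $t$ is $\mathbf h_{k,b}(t)\in\mathcal H$, a finite subset of $\mathbb C^{N_t}$; its entries have mean 0 and variance 1, it is i.i.d. over $t$ and independent over $(k,b)$. Path gains $L_{k,b}$ and transmit powers $P_b$ are constants. The channel state information (CSI) is $\mathbf H=\{\mathbf h_{k,b}:k\in\mathcal K_b,b\in\mathcal B\}\in\boldsymbol{\mathcal H}$. BS-DTX (discontinuous transmission) actions are $\mathbf p=(p_b)_{b}\in\boldsymbol{\mathcal P}\subseteq\{0,1\}^B$ and user scheduling actions are $\mathbf s=(s_k)_k\in\boldsymbol{\mathcal S}\subseteq\{0,1\}^K$.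 For $k\in\mathcal K_b$, $b\in\mathcal B_n$, the SINR is $\rho_k=P_k^{rx}/(N_0+I_k)$, with $P_k^{rx}=p_bP_bL_{k,b}\|\mathbf h_{k,b}^T\mathbf w_{k,b}\|^2s_k$ and $I_k=\sum_{n'\ne n}\sum_{b'\in\mathcal B_{n'}}p_{b'}P_{b'}L_{k,b'}\|\mathbf h_{k,b'}^T(\sum_{k'\in\mathcal K_{b'}}\mathbf w_{k',b'}s_{k'})\|^2$, where $N_0>0$ and the zero-forcing beamformers $\mathbf w_{k,b}$ solve $\sum_{k\in\mathcal K_b}\|\mathbf w_{k,b}\|^2s_k=p_b$ and $s_k\mathbf h_{k,b'}^T(\sum_{k'\in\mathcal K_{b'}}\mathbf w_{k',b'}s_{k'})=0$ for all $b'\in\mathcal B_n$, $b'\ne b$ (if several solutions, the one maximizing $\|\mathbf h_{k,b}^T\mathbf w_{k,b}\|^2$). One packet of MS $k$ is received in a slot iff $\rho_k\ge\delta_k$; there exists $(\mathbf H,\mathbf p,\mathbf s)$ with $\Pr[\rho_k(\mathbf H,\mathbf p,\mathbf s)\ge\delta_k]>0$. **Queues.** Data arrivals $A^Q_k(t)$ and renewable energy arrivals $A^E_b(t)$ are nonnegative-integer valued, i.i.d. over $t$, independent over $k$ and $b$, with means $\lambda_k^Q<1$, $\lambda_b^E<1$. With $x^+=\max\{x,0\}$ and $\mathbf I[\cdot]$ the indicator, the data queues $Q_k\in\{0,\dots,N_Q\}$ and energy queues $E_b\in\{0,\dots,N_E\}$ evolve by $Q_k(t+1)=\min\{[Q_k(t)-\mathbf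 I[\rho_k(t)\ge\delta_k]]^++A^Q_k(t),N_Q\}$, $E_b(t+1)=\min\{[E_b(t)-p_b^E(t)]^++A^E_b(t),N_E\}$. $\mathbf Q=(Q_k)\in\boldsymbol{\mathcal Q}=\{0,\dots,N_Q\}^K$, $\mathbf E=(E_b)\in\boldsymbol{\mathcal E}=\{0,\dots,N_E\}^B$, and the global state is $\boldsymbol\chi=(\mathbf E,\mathbf Q,\mathbf H)\in\boldsymbol{\mathcal X}=\boldsymbol{\mathcal E}\times\boldsymbol{\mathcal Q}\times\boldsymbol{\mathcal H}$. **Policies.** A policy is $\pi=\{\Omega^1,\Omega^2,\dots\}$ with $\Omega^t=(\Omega_p^{E,t},\Omega_p^{G,t},\Omega_s^t)$, where $\Omega_p^{E,t}(\mathbf E(t),\mathbf Q(t))=\mathbf p^E(t)\in\boldsymbol{\mathcal P}$ (renewable power action), $\Omega_p^{G,t}(\mathbf E(t),\mathbf Q(t))=\mathbf p^G(t)\in\boldsymbol{\mathcal P}$ (grid power action), $\Omega_s^t(\boldsymbol\chi(t))=\mathbf s(t)\in\boldsymbol{\mathcal S}$. It is feasible if for all $t$ and $b$: $p_b^E(t)=0$ whenever $E_b(t)=0$; $p_b(t)=p_b^E(t)+p_b^G(t)\in\{0,1\}$; and $\sum_{k\in\mathcal K_b}s_k(t)=p_b(t)$. A reduced policy $\Omega=(\Omega_p,\Omega_s)$ specifies only $\mathbf p=\Omega_p(\mathbf E,\mathbf Q)$ and $\mathbf s=\Omega_s(\boldsymbol\chi)$; the power split is then renewable-first: $p_b^E=p_b\mathbf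 I[E_b>0]$, $p_b^G=p_b\mathbf I[E_b=0]$. $\Omega_{p,b}$ is the $b$-th component of $\Omega_p$. **Partitioned actions.** $\Omega(\mathbf E,\mathbf Q)=\{(\mathbf p,\mathbf s)=(\Omega_p(\mathbf E,\mathbf Q),\Omega_s(\mathbf E,\mathbf Q,\mathbf H)):\mathbf H\in\boldsymbol{\mathcal H}\}$ is the collection of (feasible) actions for all possible CSI given $(\mathbf E,\mathbf Q)$, and $\Omega_s(\mathbf E,\mathbf Q)=\{\Omega_s(\mathbf E,\mathbf Q,\mathbf H):\mathbf H\in\boldsymbol{\mathcal H}\}$. **Problem.** For constants $\beta_k>0$, $\gamma_b>0$ and a monotonically increasing function $f$, minimize over feasible $\pi$ $$J_\pi^{(\boldsymbol\beta,\boldsymbol\gamma)}(\boldsymbol\chi(1))=\sum_k\beta_k\limsup_{T\to\infty}\tfrac1T\mathbb E^\pi\Big[\sum_{t=1}^Tf(Q_k(t))\Big]+\sum_b\gamma_b\limsup_{T\to\infty}\tfrac1T\mathbb E^\pi\Big[\sum_{t=1}^Tp_b^G(t)\Big].$$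
   Formalization: The set P of BS-DTX actions is assumed closed under the renewable-first split (for p in P, both p^E and p^G lie in P); otherwise, e.g. P={00,11} and E=(1,0), the stationary policy from the Bellman equation need not be a feasible policy. *)

(* Defs.v *)
From HB Require Import structures.
From mathcomp Require Import all_boot all_order all_algebra finmap.
From mathcomp Require Import all_classical all_reals all_analysis.
From mathcomp.real_closed Require Import complex.

Set Implicit Arguments.
Unset Strict Implicit.
Unset Printing Implicit Defensive.
Import Order.TTheory GRing.Theory Num.Theory.
Local Open Scope classical_set_scope.
Local Open Scope ring_scope.

Definition is_minimum {disp} {X : porderType disp} {U : Type}
    (A : set U) (F : U -> X) (m : X) : Prop :=
  (exists2 u, A u & F u = m) /\ (forall u, A u -> (m <= F u)%O).

Definition mutually_independent {R : realType} {d} {T : measurableType d}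
    (P : probability T R) (I : choiceType) (F : I -> set (set T)) : Prop :=
  forall (J : {fset I}) (A : I -> set T),
    (forall i, i \in J -> F i (A i)) ->
    P (\bigcap_(i in [set` J]) A i) = (\prod_(i <- J) P (A i))%E.

Definition sqmod {R : realType} (z : R[i]) : R :=
  complex.Re z ^+ 2 + complex.Im z ^+ 2.

Definition sqnorm {R : realType} {n} (w : 'cV[R[i]]_n) : R :=
  \sum_i sqmod (w i 0).

(* h^T w: plain transpose, no conjugation. *)
Definition pairing {R : realType} {n} (h w : 'cV[R[i]]_n) : R[i] :=
  (h^T *m w) 0 0.

(** * The network *)

(* [assoc k] is the BS serving MS [k], so that the disjoint sets K_b are the
   fibres of [assoc].
   [alphabet] is the finite set of values of the fading vectors.
   [beam h p s k] is the vector w_{k,b}, b = assoc k, used when the fading is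
   h and the actions are (p, s): the zero-forcing problem need not have a
   unique solution, so a selection is part of the data; it is constrained by
   [zf_optimal] in [network_ok]. *)
Record network (R : realType) := Network {
  nBS : nat;
  nMS : nat;
  nAnt : nat;
  NQ : nat;
  NE : nat;
  clusters : {set {set 'I_nBS}};
  assoc : 'I_nMS -> 'I_nBS;
  alphabet : {fset 'cV[R[i]]_nAnt};
  gain : 'I_nMS -> 'I_nBS -> R;
  power : 'I_nBS -> R;
  noise : R;
  threshold : 'I_nMS -> R;
  dtx_actions : {set {ffun 'I_nBS -> bool}};
  sched_actions : {set {ffun 'I_nMS -> bool}};
  beam : {ffun 'I_nMS * 'I_nBS -> alphabet} ->
         {ffun 'I_nBS -> bool} -> {ffun 'I_nMS -> bool} ->
         'I_nMS -> 'cV[R[i]]_nAnt;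
  rateQ : 'I_nMS -> R;
  rateE : 'I_nBS -> R;
  weightQ : 'I_nMS -> R;
  weightE : 'I_nBS -> R;
  fcost : nat -> R }.

Notation dtx N := {ffun 'I_(nBS N) -> bool}.
Notation sched N := {ffun 'I_(nMS N) -> bool}.
Notation fading N := {ffun 'I_(nMS N) * 'I_(nBS N) -> alphabet N}.
(* The CSI only contains the direct links h_{k,b}, k in K_b. *)
Notation csi N := {ffun 'I_(nMS N) -> alphabet N}.
Notation energy N := {ffun 'I_(nBS N) -> 'I_(NE N).+1}.
Notation data N := {ffun 'I_(nMS N) -> 'I_(NQ N).+1}.
Notation qstate N := (energy N * data N)%type.

Section Network.
Context {R : realType} (N : network R).
Implicit Types (h : fading N) (H : csi N) (p : dtx N) (s : sched N)
  (k : 'I_(nMS N)) (b : 'I_(nBS N)) (w : 'I_(nMS N) -> 'cV[R[i]]_(nAnt N))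
  (E : energy N) (Q : data N).

Definition users b : {set 'I_(nMS N)} := [set k | assoc k == b]%SET.

Definition cluster_of b : {set 'I_(nBS N)} := finset.pblock (clusters N) b.

Definition tx_beam s w b : 'cV[R[i]]_(nAnt N) :=
  \sum_(k in users b) (s k)%:R *: w k.

Definition chan h k b : 'cV[R[i]]_(nAnt N) := val (h (k, b)).

Definition zf_solution h p s w : Prop :=
  (forall b, \sum_(k in users b) sqnorm (w k) * (s k)%:R = (p b)%:R) /\
  (forall k b', b' \in cluster_of (assoc k) -> b' != assoc k ->
     (s k)%:R * pairing (chan h k b') (tx_beam s w b') = 0).

(* Only scheduled users matter: w_k is unconstrained when s_k = 0. *)
Definition zf_optimal h p s w : Prop :=
  zf_solution h p s w /\
  forall w', zf_solution h p s w' -> forall k, s k ->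
    sqmod (pairing (chan h k (assoc k)) (w' k)) <=
    sqmod (pairing (chan h k (assoc k)) (w k)).

Definition rx_power h p s k : R :=
  let b := assoc k in
  (p b)%:R * power b * gain k b *
    sqmod (pairing (chan h k b) (beam h p s k)) * (s k)%:R.

Definition interference h p s k : R :=
  \sum_(C in clusters N | C != cluster_of (assoc k)) \sum_(b' in C)
    (p b')%:R * power b' * gain k b' *
      sqmod (pairing (chan h k b') (tx_beam s (beam h p s) b')).

Definition sinr h p s k : R :=
  rx_power h p s k / (noise N + interference h p s k).

Definition received h p s k : bool := threshold k <= sinr h p s k.

Definition coupled p s : Prop :=
  forall b, (\sum_(k in users b) s k)%N = p b.

Definition admissible p s : Prop :=
  [/\ p \in dtx_actions N, s \in sched_actions N & coupled p s].

Definition renewable_part E p : dtx N := [ffun b => p b && (E b != ord0)].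
Definition grid_part E p : dtx N := [ffun b => p b && (E b == ord0)].

(** ** One-slot dynamics *)

Definition csi_of h : csi N := [ffun k => h (k, assoc k)].

(* h with its direct links replaced by H.  As all links are independent, if h
   has the law of the fading then [with_csi H h] has the conditional law of
   the fading given that the CSI is H (also when H has probability 0). *)
Definition with_csi H h : fading N :=
  [ffun kb => if kb.2 == assoc kb.1 then H kb.1 else h kb].

Definition next_energy E (pE : dtx N) (aE : 'I_(nBS N) -> nat) : energy N :=
  [ffun b => inord (minn (E b - pE b + aE b) (NE N))].

Definition next_data Q h p s (aQ : 'I_(nMS N) -> nat) : data N :=
  [ffun k => inord (minn (Q k - received h p s k + aQ k) (NQ N))].

(* The renewable-first condition says that every p in the action set can be
   split renewable-first: p^E and p^G are again in the action set. *)
Record network_ok : Prop := NetworkOk {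
  nMS_gt0 : (0 < nMS N)%N;
  clusters_partition : finset.partition (clusters N) [set: 'I_(nBS N)]%SET;
  clusters_card : forall C, C \in clusters N -> #|C| = nAnt N;
  noise_gt0 : 0 < noise N;
  beam_zf : forall h p s, coupled p s -> zf_optimal h p s (beam h p s);
  renewable_first_ok : forall E p, p \in dtx_actions N ->
    renewable_part E p \in dtx_actions N /\ grid_part E p \in dtx_actions N;
  rateQ_lt1 : forall k, rateQ k < 1;
  rateE_lt1 : forall b, rateE b < 1;
  weightQ_gt0 : forall k, 0 < weightQ k;
  weightE_gt0 : forall b, 0 < weightE b;
  fcost_incr : {homo @fcost R N : m n / (m <= n)%N >-> m <= n} }.

(** * Policies *)

(* Slots t = 1, 2, ... are indexed by 0, 1, ... *)
Record policy := Policy {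
  pol_pE : nat -> energy N -> data N -> dtx N;
  pol_pG : nat -> energy N -> data N -> dtx N;
  pol_s : nat -> energy N -> data N -> csi N -> sched N }.

Definition total_power (pE pG : dtx N) : dtx N := [ffun b => pE b || pG b].

Definition pol_p (pi : policy) t E Q : dtx N :=
  total_power (pol_pE pi t E Q) (pol_pG pi t E Q).

Definition feasible (pi : policy) : Prop :=
  forall t E Q,
    [/\ pol_pE pi t E Q \in dtx_actions N,
        pol_pG pi t E Q \in dtx_actions N,
        forall b, E b = ord0 -> pol_pE pi t E Q b = false,
        forall b, (pol_pE pi t E Q b + pol_pG pi t E Q b <= 1)%N &
        forall H, admissible (pol_p pi t E Q) (pol_s pi t E Q H)].

(* A partitioned action: the p-action and the s-action for each CSI. *)
Record paction := PAction { act_p : dtx N; act_s : csi N -> sched N }.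

Definition feasible_paction (a : paction) : Prop :=
  forall H, admissible (act_p a) (act_s a H).

Definition stationary (Om : energy N -> data N -> paction) : policy :=
  {| pol_pE := fun _ E Q => renewable_part E (act_p (Om E Q));
     pol_pG := fun _ E Q => grid_part E (act_p (Om E Q));
     pol_s := fun _ E Q H => act_s (Om E Q) H |}.

End Network.

(** * Randomness *)

Section Stochastic.
Context {R : realType} (N : network R) {d} {T : measurableType d}
  (P : probability T R).

Record exogenous := Exogenous {
  fade : 'I_(nMS N) -> 'I_(nBS N) -> nat -> T -> alphabet N;
  arrQ : 'I_(nMS N) -> nat -> T -> nat;
  arrE : 'I_(nBS N) -> nat -> T -> nat }.

(* For X_t valued in a countable set with the discrete sigma-algebra. *)
Definition discrete_rvs {U : Type} (X : nat -> T -> U) : Prop :=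
  forall t (S : set U), measurable (X t @^-1` S).

Definition identically_distributed {U : Type} (X : nat -> T -> U) : Prop :=
  forall t (S : set U), P (X t @^-1` S) = P (X 0%N @^-1` S).

Definition generated_events {U : Type} (X : T -> U) : set (set T) :=
  [set A | exists S : set U, A = X @^-1` S].

Definition source_events (X : exogenous)
    (i : nat * ('I_(nMS N) * 'I_(nBS N) + 'I_(nMS N) + 'I_(nBS N))) :
    set (set T) :=
  match i with
  | (t, inl (inl (k, b))) => generated_events (fade X k b t)
  | (t, inl (inr k)) => generated_events (arrQ X k t)
  | (t, inr b) => generated_events (arrE X b t)
  end.

Variable X : exogenous.

Definition fading_at t (x : T) : fading N :=
  [ffun kb => fade X kb.1 kb.2 t x].

Definition fade_entry k b t i (x : T) : R[i] := (val (fade X k b t x)) i 0.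

(* Probability that MS k receives a packet given the CSI and the actions. *)
Definition reception_prob (H : csi N) (p : dtx N) (s : sched N) k : \bar R :=
  P [set x | received (with_csi H (fading_at 0 x)) p s k].

Definition csi_prob (H : csi N) : \bar R :=
  P [set x | csi_of (fading_at 0 x) = H].

Record exogenous_ok : Prop := ExogenousOk {
  fade_rv : forall k b, discrete_rvs (fade X k b);
  arrQ_rv : forall k, discrete_rvs (arrQ X k);
  arrE_rv : forall b, discrete_rvs (arrE X b);
  fade_id : forall k b, identically_distributed (fade X k b);
  arrQ_id : forall k, identically_distributed (arrQ X k);
  arrE_id : forall b, identically_distributed (arrE X b);
  sources_indep : mutually_independent P (source_events X);
  fade_mean : forall k b t i,
    'E_P[fun x => complex.Re (fade_entry k b t i x)]%E = 0%E /\
    'E_P[fun x => complex.Im (fade_entry k b t i x)]%E = 0%E;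
  fade_var : forall k b t i,
    'E_P[fun x => sqmod (fade_entry k b t i x)]%E = 1%E;
  arrQ_mean : forall k t, 'E_P[fun x => (arrQ X k t x)%:R]%E = (rateQ k)%:E;
  arrE_mean : forall b t, 'E_P[fun x => (arrE X b t x)%:R]%E = (rateE b)%:E;
  reception_possible : forall k, exists H p s,
    [/\ admissible p s, (0 < csi_prob H)%E & (0 < reception_prob H p s k)%E] }.

(** ** The controlled process and its average cost *)

(* The fading process when the CSI of the first slot is H1. *)
Definition fading_from (H1 : csi N) t (x : T) : fading N :=
  if t is 0%N then with_csi H1 (fading_at 0 x) else fading_at t x.

(* The global state of the first slot is ((E1, Q1), H1) = (x1, H1). *)
Fixpoint trajectory (pi : policy N) (x1 : qstate N) (H1 : csi N) t (x : T) :
    qstate N :=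
  if t is t'.+1 then
    let: (E, Q) := trajectory pi x1 H1 t' x in
    let h := fading_from H1 t' x in
    (next_energy E (pol_pE pi t' E Q) (fun b => arrE X b t' x),
     next_data Q h (pol_p pi t' E Q) (pol_s pi t' E Q (csi_of h))
       (fun k => arrQ X k t' x))
  else x1.

Definition time_average (Y : nat -> T -> R) : \bar R :=
  limn_esup (fun n => (n%:R^-1)%:E * 'E_P[fun x => (\sum_(t < n) Y t x)%R])%E.

Definition average_cost (pi : policy N) (x1 : qstate N) (H1 : csi N) :
    \bar R :=
  (\sum_k (weightQ k)%:E *
     time_average (fun t x => fcost N ((trajectory pi x1 H1 t x).2 k)) +
   \sum_b (weightE b)%:E *
     time_average (fun t x =>
       let: (E, Q) := trajectory pi x1 H1 t x in
       (pol_pG pi t E Q b)%:R%R))%E.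

Definition optimal (pi : policy N) : Prop :=
  feasible pi /\
  forall pi' x1 H1, feasible pi' ->
    (average_cost pi x1 H1 <= average_cost pi' x1 H1)%E.

(** ** Bellman equation *)

Definition stage_cost (E : energy N) (Q : data N) (a : paction N) : R :=
  \sum_k weightQ k * fcost N (Q k) +
  \sum_b weightE b * (act_p a b)%:R * (E b == ord0)%:R.

(* Pr[y | (E, Q, H), (p, s)] under the renewable-first power split; the
   remaining randomness is that of the arrivals and of the links outside the
   CSI. *)
Definition full_kernel (E : energy N) (Q : data N) (H : csi N)
    (p : dtx N) (s : sched N) (y : qstate N) : R :=
  fine (P [set x |
    (next_energy E (renewable_part E p) (fun b => arrE X b 0 x),
     next_data Q (with_csi H (fading_at 0 x)) p s (fun k => arrQ X k 0 x))
    = y]).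

Definition mean_kernel (E : energy N) (Q : data N) (a : paction N) (y : qstate N) :
    R :=
  \sum_(H : csi N) fine (csi_prob H) * full_kernel E Q H (act_p a) (act_s a H) y.

Definition bellman_rhs (V : energy N -> data N -> R) E Q (a : paction N) : R :=
  stage_cost E Q a + \sum_(y : qstate N) mean_kernel E Q a y * V y.1 y.2.

Definition bellman (theta : R) (V : energy N -> data N -> R) : Prop :=
  forall E Q, is_minimum [set a | feasible_paction a] (bellman_rhs V E Q)
                (theta + V E Q).

Definition attains_minimum (V : energy N -> data N -> R)
    (Om : energy N -> data N -> paction N) : Prop :=
  forall E Q, feasible_paction (Om E Q) /\
    forall a, feasible_paction a ->
      bellman_rhs V E Q (Om E Q) <= bellman_rhs V E Q a.

End Stochastic.

Arguments exogenous {R} N {d} T.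

(* Main.v *)
Require Import Defs.
From HB Require Import structures.
From mathcomp Require Import all_boot all_order all_algebra finmap.
From mathcomp Require Import all_classical all_reals all_analysis.
From mathcomp Require Import measurable_realfun ring lra zify.

(** The arrivals matter only up to the queue capacities, so the controlled
    process is a finite Markov decision process driven by i.i.d. noise on a
    finite set, with the renewable-first split imposed in the Bellman equation
    but not in the definition of a policy.

    Existence of a solution is the vanishing discount argument, carried out on
    approximate discounted fixed points.  Two couplings control them: started
    with more energy and less data, the same actions cost no more; started with
    less energy and less data, they cost at most [energy_gap] more, since a
    missing unit of energy is paid for once.  Moreover, from every state all
    data queues empty with positive probability in bounded time.  Hence the
    relative values are bounded, and a limit along an ultrafilter solves the
    equation.  This particular solution inherits the second inequality, which
    shows that wasting stored energy never pays; so its [theta] bounds the cost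
    of every feasible policy from below.

    A minimising stationary policy of an arbitrary solution has average cost
    exactly [theta]: as the objective is a sum of upper limits, this needs each
    time average to converge, which follows from the decomposition
    [f = u + w - K w], [K u = u], of functions on a finite Markov chain.
    Comparing minimising policies shows that [theta] is the same for all
    solutions. *)

Set Implicit Arguments.
Unset Strict Implicit.
Unset Printing Implicit Defensive.
Import Order.TTheory GRing.Theory Num.Theory.
Import numFieldNormedType.Exports.
Local Open Scope classical_set_scope.
Local Open Scope ring_scope.

(** * Limits along an ultrafilter *)

Section UltrafilterLimits.
Context {R : realType}.

(** Compactness of the segment gives the image filter a cluster point, and an ultrafilter converges
    to each of its cluster points. *)
Lemma ultra_bounded_cvg (U : set_system nat) (u : nat -> R) (M : R) :
  UltraFilter U -> (forall n, `|u n| <= M) -> cvg (u @ U).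
Proof.
move=> UU uM.
have [p [_ clp]] : `[- M, M] `&` cluster (u @ U) !=set0.
  apply: (@segment_compact R (- M) M (u @ U)).
  rewrite nbhs_filterE /fmap /=.
  have : \forall n \near U, -M <= u n <= M by apply: filterE => n; rewrite -ler_norml.
  by apply: filterS => n Hn; rewrite /= in_itv.
apply/cvg_ex; exists p => /= B pB.
have [//|UC] := in_ultra_setVsetC (u @^-1` B) UU.
by have [y [yC yB]] := clp (~` B) B UC pB.
Qed.

Lemma ultra_finer_infty :
  exists2 U : set_system nat, UltraFilter U & \oo `<=` U.
Proof. by have [U [UU sU]] := ultraFilterLemma eventually_filter; exists U. Qed.

(** The upper limit is an infimum of suprema over eventual sets of indices; each such set belongs to
    [U], so its supremum cannot lie strictly below the limit along [U]. *)
Lemma limn_esup_ge_ultra (U : set_system nat) (u : nat -> R) (l : R) :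
  UltraFilter U -> \oo `<=` U -> u @ U --> l ->
  (l%:E <= limn_esup (EFin \o u))%E.
Proof.
move=> UU sU ul; apply: le_ereal_inf_tmp => _ /= [V /sU UV <-].
rewrite leNgt; apply/negP => supl.
have : \forall n \near U, (ereal_sup [set (EFin \o u) m | m in V] < (u n)%:E)%E.
  move: supl; case: (ereal_sup _) => [r||] //.
    by rewrite lte_fin => rl; near=> n; rewrite lte_fin; near: n; exact: cvgr_gt ul r rl.
  by move=> _; apply: filterE => n; rewrite ltNyr.
move=> near_lt; have [n [Vn]] := filter_ex (filterI UV near_lt).
rewrite ltNge => /negP; apply; apply: ereal_sup_ubound; by exists n.
Unshelve. all: by end_near. Qed.

Lemma cvg_sumr (I : finType) (T : Type) (F : set_system T) (FF : Filter F)
    (f : I -> T -> R) (l : I -> R) :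
  (forall i, f i @ F --> l i) ->
  (\sum_i f i t @[t --> F]) --> \sum_i l i.
Proof. by move=> fl; apply: cvg_big => // ; exact: add_continuous. Qed.

End UltrafilterLimits.

(** * Finite Markov chains *)

Section FiniteMarkovChain.
Context {R : realType} {S : finType} (k : S -> S -> R).
Hypothesis k_ge0 : forall x y, 0 <= k x y.
Hypothesis k_sum1 : forall x, \sum_y k x y = 1.

Local Notation K f x := (\sum_y k x y * f y).

(** Together the hypotheses give [w - t u = K^t w], which stays bounded as [t] grows, so [u]
    vanishes. *)
Lemma coboundary_invariant_eq0 (u w : S -> R) :
  (forall x, K u x = u x) -> (forall x, u x = w x - K w x) ->
  forall x, u x = 0.
Proof.
move=> uK uw.
pose M := \sum_y `|w y| : R.
have wM t : forall x, `|w x - t%:R * u x| <= M.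
  elim: t => [|t IH] x.
    rewrite mul0r subr0 /M (bigD1 x) //= lerDl.
    exact: sumr_ge0.
  have -> : w x - t.+1%:R * u x = K (fun y => w y - t%:R * u y) x.
    under eq_bigr do rewrite mulrBr mulrCA.
    rewrite big_split /= sumrN -mulr_sumr uK.
    by have := uw x; rewrite -natr1; lra.
  apply: (le_trans (ler_norm_sum _ _ _)).
  have -> : M = \sum_y k x y * M by rewrite -mulr_suml k_sum1 mul1r.
  by apply: ler_sum => y _; rewrite normrM (ger0_norm (k_ge0 x y)); apply: ler_wpM2l.
move=> x; apply/eqP; apply/negPn/negP => ux0.
pose n := Num.truncn ((`|w x| + M) / `|u x|).
have ux : 0 < `|u x| by rewrite normr_gt0.
have := truncnS_gt ((`|w x| + M) / `|u x|).
rewrite ltr_pdivrMr// -/n => ltn.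
have := wM n.+1 x; rewrite distrC => /(le_trans (lerB_dist _ _)).
by rewrite normrM normr_nat; lra.
Qed.

(** The kernel and the image of [1 - K] meet only in 0 by the previous lemma, hence by a dimension
    count they span all functions. The invariant part [u] carries the long-run average of [f]. *)
Lemma poisson_decomposition (f : S -> R) : exists u w : S -> R,
  (forall x, K u x = u x) /\ (forall x, f x = u x + w x - K w x).
Proof.
pose n := #|S|.
(* Functions are row vectors, on which matrices act from the right; hence the transpose of the
   kernel. *)
pose Q : 'M[R]_n := \matrix_(i, j) k (enum_val j) (enum_val i).
pose vec (g : S -> R) : 'rV[R]_n := \row_j g (enum_val j).
pose fn (v : 'rV[R]_n) (x : S) : R := v 0 (enum_rank x).
have fnK v : vec (fn v) = v.
  by apply/rowP => j; rewrite mxE /fn enum_valK.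
have fnQ v x : fn (v *m Q) x = K (fn v) x.
  rewrite /fn mxE (reindex (@enum_rank S)) /=; last first.
    by exists (@enum_val S S) => ? _; rewrite ?enum_rankK ?enum_valK.
  by apply: eq_bigr => y _; rewrite mxE !enum_rankK mulrC.
pose A : 'M[R]_n := 1%:M - Q.
have vA v x : fn (v *m A) x = fn v x - K (fn v) x.
  by rewrite mulmxBr mulmx1 -fnQ /fn !mxE.
have cap0 : (kermx A :&: A)%MS = 0.
  apply/eqP/rowV0P => v; rewrite sub_capmx => /andP[/sub_kermxP vA0 /submxP[w vw]].
  apply/rowP => j; rewrite mxE.
  have -> : v 0 j = fn v (enum_val j) by rewrite /fn enum_valK.
  apply: (@coboundary_invariant_eq0 _ (fn w)) => x.
    by have := vA v x; rewrite vA0 /fn mxE => /esym/eqP; rewrite subr_eq0 => /eqP/esym.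
  by rewrite vw vA.
have full : row_full (kermx A + A)%MS.
  rewrite /row_full; have := mxrank_sum_cap (kermx A) A.
  by rewrite cap0 mxrank0 addn0 mxrank_ker subnK ?rank_leq_row// => ->.
have /sub_addsmxP[[a w] /= fE] : (vec f <= kermx A + A)%MS by exact: submx_full.
exists (fn (a *m kermx A)), (fn w); split => x.
  have := vA (a *m kermx A) x; rewrite -mulmxA mulmx_ker mulmx0 /fn mxE.
  by move=> /esym/eqP; rewrite subr_eq0 => /eqP/esym.
rewrite -addrA -vA.
have -> : f x = fn (vec f) x by rewrite /fn mxE enum_rankK.
by rewrite fE /fn mxE.
Qed.

End FiniteMarkovChain.

(** * Average-cost Bellman equation of a finite decision process *)

Section FiniteAverage.
Context {R : realType} {Z : finType} (mu : Z -> R).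
Hypothesis mu_ge0 : forall z, 0 <= mu z.
Hypothesis mu_sum1 : \sum_z mu z = 1.

Definition avg (f : Z -> R) : R := \sum_z mu z * f z.

Lemma avg_cst c : avg (fun=> c) = c.
Proof. by rewrite /avg -mulr_suml mu_sum1 mul1r. Qed.

Lemma avgD f f' : avg (fun z => f z + f' z) = avg f + avg f'.
Proof. by rewrite /avg -big_split; apply: eq_bigr => z _; rewrite mulrDr. Qed.

Lemma avgB f f' : avg (fun z => f z - f' z) = avg f - avg f'.
Proof. by rewrite /avg -sumrB; apply: eq_bigr => z _; rewrite mulrBr. Qed.

Lemma le_avg f f' : (forall z, f z <= f' z) -> avg f <= avg f'.
Proof. by move=> ff'; apply: ler_sum => z _; apply: ler_wpM2l. Qed.

Lemma norm_avg_le f c : (forall z, `|f z| <= c) -> `|avg f| <= c.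
Proof.
move=> fc; rewrite -(avg_cst c); apply: (le_trans (ler_norm_sum _ _ _)).
by apply: ler_sum => z _; rewrite normrM ger0_norm//; apply: ler_wpM2l.
Qed.

Lemma avg_le_gap f M z0 : (forall z, f z <= M) ->
  avg f <= M - mu z0 * (M - f z0).
Proof.
move=> fM; have : mu z0 * (M - f z0) <= avg (fun z => M - f z).
  rewrite /avg (bigD1 z0) //= lerDl sumr_ge0// => z _.
  by rewrite mulr_ge0// subr_ge0.
by rewrite avgB avg_cst; lra.
Qed.

Lemma positive_weights_bounded_below :
  exists eps, [/\ 0 < eps, eps <= 1 & forall z, 0 < mu z -> eps <= mu z].
Proof.
(* The default value 1 of the minimum yields [eps <= 1]. *)
exists (\big[Num.min/1]_(z | 0 < mu z) mu z); split.
- by apply/bigmin_gtP.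
- by rewrite bigmin_le_id.
- by move=> z z0; exact: (bigmin_le_cond _ _ z0).
Qed.

End FiniteAverage.

(** * Vanishing discount for a finite decision process *)

Section FiniteMDP.
Context {R : realType} {S Z A : finType} (mu : Z -> R).
Hypothesis mu_ge0 : forall z, 0 <= mu z.
Hypothesis mu_sum1 : \sum_z mu z = 1.
Variables (step : S -> A -> Z -> S) (g : S -> A -> R) (F : {set A}) (a0 : A).
Hypothesis Fa0 : a0 \in F.

Definition qvalue (alpha : R) (v : S -> R) x a : R :=
  g x a + alpha * avg mu (fun z => v (step x a z)).

(* A coupling of the chains started at [x] and [x'] and run with the same
   actions and noise: the cost from [x] exceeds the one from [x'] by at most
   the decrease of [D]. *)
Definition cost_coupling (L : S -> S -> Prop) (D : S -> S -> R) : Prop :=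
  forall x x', L x x' -> 0 <= D x x' /\ forall a z,
    L (step x a z) (step x' a z) /\
    g x a + D (step x a z) (step x' a z) <= g x' a + D x x'.

Definition greedy alpha v x : A :=
  [arg min_(a < a0 in F) qvalue alpha v x a]%O.

Definition optimality_op alpha v x : R := qvalue alpha v x (greedy alpha v x).

Lemma greedyP alpha v x : greedy alpha v x \in F /\
  forall a, a \in F -> optimality_op alpha v x <= qvalue alpha v x a.
Proof. by rewrite /optimality_op /greedy; case: arg_minP. Qed.

Definition value_iter alpha n : S -> R :=
  iter n (optimality_op alpha) (fun=> 0).

Lemma value_iterS alpha n x :
  value_iter alpha n.+1 x = optimality_op alpha (value_iter alpha n) x.
Proof. by []. Qed.

Let c : R := \sum_x \sum_a `|g x a|.

Lemma cost_le x a : `|g x a| <= c.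
Proof.
rewrite /c (bigD1 x) //= (bigD1 a) //= -addrA lerDl addr_ge0 ?sumr_ge0//.
by move=> y _; apply: sumr_ge0.
Qed.

Lemma cost_bound_ge0 : 0 <= c.
Proof. by apply: sumr_ge0 => x _; apply: sumr_ge0. Qed.

Section Discount.
Variable alpha : R.
Hypotheses (alpha_ge0 : 0 <= alpha) (alpha_lt1 : alpha < 1).

(** Induction on the horizon: from [x] the greedy action of [x'] is one of the choices, and under it
    the extra stage cost is paid for by the decrease of [D]. As [D] is nonnegative, discounting its
    future value only helps. *)
Lemma value_iter_coupling L D n x x' : cost_coupling L D -> L x x' ->
  value_iter alpha n x <= value_iter alpha n x' + D x x'.
Proof.
move=> LD; elim: n x x' => [|n IH] x x' Lxx'.
  by rewrite /= add0r; have [] := LD _ _ Lxx'.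
rewrite !value_iterS; set v := value_iter alpha n.
have [aF _] := greedyP alpha v x'; set a := greedy _ _ _ in aF *.
have [_ vx] := greedyP alpha v x; apply: (le_trans (vx _ aF)).
rewrite {1}/optimality_op -/a.
have [D0 LDa] := LD _ _ Lxx'.
rewrite /qvalue; set Dz := fun z => D (step x a z) (step x' a z).
have vD : avg mu (fun z => v (step x a z)) <=
    avg mu (fun z => v (step x' a z)) + avg mu Dz.
  by rewrite -avgD; apply: le_avg => // z; apply: IH; have [] := LDa a z.
have D_ge0 : 0 <= avg mu Dz.
  rewrite -(avg_cst mu_sum1 0); apply: le_avg => // z.
  by have [Lz _] := LDa a z; have [] := LD _ _ Lz.
have D_le : avg mu Dz <= g x' a + D x x' - g x a.
  rewrite -[leRHS](avg_cst mu_sum1); apply: le_avg => // z.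
  by have [_] := LDa a z; rewrite /Dz; lra.
have := ler_wpM2l alpha_ge0 vD; have : alpha * avg mu Dz <= avg mu Dz.
  by rewrite ler_piMl// ltW.
lra.
Qed.

(** [c / (1 - alpha)] is the total of discounted stage costs of size [c]. The product form bounds
    [(1 - alpha) w] uniformly in [alpha], which is what survives as [alpha] tends to 1. *)
Lemma value_iter_bound n x : `|value_iter alpha n x| * (1 - alpha) <= c.
Proof.
have a1 : 0 < 1 - alpha by rewrite subr_gt0.
rewrite -ler_pdivlMr//; elim: n x => [|n IH] x.
  by rewrite normr0; apply: divr_ge0; [exact: cost_bound_ge0 | exact: ltW].
rewrite value_iterS /optimality_op /qvalue (le_trans (ler_normD _ _))//.
have -> : c / (1 - alpha) = c + alpha * (c / (1 - alpha)).
  by field; rewrite subr_eq0 gt_eqF.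
rewrite lerD ?cost_le// normrM ger0_norm// ler_wpM2l//.
exact: norm_avg_le.
Qed.

Lemma optimality_op_contraction v v' e :
  (forall x, `|v x - v' x| <= e) ->
  forall x, `|optimality_op alpha v x - optimality_op alpha v' x| <= alpha * e.
Proof.
move=> ve x.
have half u u' : (forall x, u x - u' x <= e) ->
    optimality_op alpha u x <= optimality_op alpha u' x + alpha * e.
  move=> ue; have [aF _] := greedyP alpha u' x.
  have [_ ux] := greedyP alpha u x; apply: (le_trans (ux _ aF)).
  rewrite /optimality_op /qvalue -addrA -mulrDr lerD2l ler_wpM2l// -lerBlDl.
  by rewrite -avgB -(avg_cst mu_sum1 e); apply: le_avg.
have h1 : optimality_op alpha v x <= optimality_op alpha v' x + alpha * e.
  by apply: half => y; apply: le_trans (ler_norm _) (ve y).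
have h2 : optimality_op alpha v' x <= optimality_op alpha v x + alpha * e.
  by apply: half => y; apply: le_trans (ler_norm _) _; rewrite distrC.
by rewrite ler_norml; apply/andP; split; lra.
Qed.

Lemma value_iter_cauchy n x :
  `|value_iter alpha n.+1 x - value_iter alpha n x| <= alpha ^+ n * c.
Proof.
elim: n x => [|n IH] x.
  rewrite expr0 mul1r subr0 value_iterS /optimality_op /qvalue.
  by rewrite (avg_cst mu_sum1) mulr0 addr0 cost_le.
by rewrite exprS -mulrA; apply: optimality_op_contraction.
Qed.

(** Successive iterates differ by at most [alpha^n c], which falls below [eta]. An iterate is kept
    instead of the exact fixed point, so that the bounds proved for iterates apply to it
    directly. *)
Lemma approximate_fixpoint eta : 0 < eta -> exists n,
  let w := value_iter alpha n in
  (forall x a, a \in F -> w x <= qvalue alpha w x a + eta) /\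
  (forall x, exists2 a, a \in F & qvalue alpha w x a <= w x + eta).
Proof.
move=> eta0.
have : (fun n => alpha ^+ n * c) @ \oo --> 0 * c.
  apply: cvgMr_tmp; apply: cvg_expr; by rewrite ger0_norm.
rewrite mul0r => /cvgr_lt/(_ _ eta0)[n _ /(_ n (leqnn _)) /= cn].
exists n; set w := value_iter alpha n.
have wd x : `|optimality_op alpha w x - w x| <= eta.
  exact: (le_trans (value_iter_cauchy n x)) (ltW cn).
split=> x.
  move=> a aF; have [_ /(_ a aF)] := greedyP alpha w x.
  by have := wd x; rewrite distrC ler_norml => /andP[_]; lra.
have [aF _] := greedyP alpha w x; exists (greedy alpha w x) => //.
by have := wd x; rewrite ler_norml /optimality_op => /andP[_]; lra.
Qed.

End Discount.

(** In the application [x0] is the state with all queues empty, [r] the total data backlog, [L1] the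
    order by more energy and less data, and [L2] with gap [D2] the order by less energy and less
    data. *)
Variables (r : S -> nat) (x0 : S) (L1 L2 : S -> S -> Prop) (D2 : S -> S -> R).
Hypothesis coupling1 : cost_coupling L1 (fun _ _ => 0).
Hypothesis coupling2 : cost_coupling L2 D2.
Hypothesis L1x0 : forall x, r x = 0%N -> L1 x x0.
Hypothesis L2x0 : forall x, L2 x0 x.
Hypothesis r_decr : forall x, (0 < r x)%N ->
  exists a z, [/\ a \in F, 0 < mu z & (r (step x a z) < r x)%N].

(* From every state the rank reaches 0 within a bounded time with a
   probability bounded below, which bounds the gap between the largest value
   and the value at [x0]. *)
Lemma span_bound : exists C, forall alpha (w : S -> R), 0 <= alpha <= 1 ->
  (forall x, `|w x| * (1 - alpha) <= c) ->
  (forall x a, a \in F -> w x <= qvalue alpha w x a + 1) ->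
  (forall x, r x = 0%N -> w x <= w x0) ->
  (forall x, w x0 <= w x + D2 x0 x) ->
  forall x, `|w x - w x0| <= C.
Proof.
have [eps [eps0 eps1 epsmu]] := positive_weights_bounded_below mu.
pose n0 := (\max_x r x)%N.
(* One step down the rank loses at most [c] for the stage cost, [c] for replacing [alpha] by 1, and
   1 for the approximation error. *)
pose Cd := 2 * c + 1.
pose C1 := n0%:R * Cd / eps ^+ n0.
have c0 := cost_bound_ge0.
exists (C1 + \sum_x `|D2 x0 x|) => alpha w /andP[al0 al1] wb wq w0 wl.
have [xm _ wM] : exists2 xm, xm \in S & forall x, w x <= w xm.
  by case: (@arg_maxP _ _ S x0 xpredT w) => // i _ H; exists i => // x; apply: H.
set M := w xm in wM.
(* If [w x0] is far below the maximum [M], so is [w x] for each [x] of rank at most [n], up to the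
   factor [eps^n] and [n] losses [Cd]. At the maximiser [xm] the right side is 0, which will bound
   [M - w x0]. *)
have gap n : forall x, (r x <= n)%N ->
    eps ^+ n * (M - w x0) - n%:R * Cd <= M - w x.
  elim: n => [|n IH] x.
    by rewrite leqn0 => /eqP/w0; rewrite expr0; lra.
  rewrite leq_eqVlt => /orP[/eqP rx|]; last first.
    rewrite ltnS => /IH; apply: le_trans.
    have : 0 <= (eps ^+ n - eps ^+ n.+1) * (M - w x0).
      apply: mulr_ge0; rewrite subr_ge0 ?wM// exprS ler_piMl// exprn_ge0 ?ltW//.
    rewrite -natr1 /Cd; lra.
  have [a [z [aF /epsmu epsz rz]]] : exists a z,
      [/\ a \in F, 0 < mu z & (r (step x a z) < r x)%N].
    by apply: r_decr; rewrite rx.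
  rewrite rx ltnS in rz.
  have := IH _ rz; set y := step x a z in rz *.
  have := wq x a aF; rewrite /qvalue; set q := avg _ _ => wx.
  have qM : q <= M - eps * (M - w y).
    apply: le_trans (avg_le_gap mu_ge0 mu_sum1 z _) _ => [z'|]; first exact: wM.
    by rewrite lerD2l lerN2 ler_wpM2r// subr_ge0.
  have qc : `|(1 - alpha) * q| <= c.
    have -> : (1 - alpha) * q = avg mu (fun z => (1 - alpha) * w (step x a z)).
      by rewrite /q /avg mulr_sumr; apply: eq_bigr => ? _; rewrite mulrCA.
    apply: norm_avg_le => // z'; rewrite normrM mulrC (@ger0_norm _ (1 - _)) //.
    by rewrite subr_ge0.
  have gc := cost_le x a; rewrite ler_norml in gc; case/andP: gc => _ gc.
  rewrite ler_norml in qc; case/andP: qc => qc _.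
  move=> IHy; have := ler_wpM2l (ltW eps0) IHy.
  rewrite exprS -natr1 /Cd.
  have : 0 <= (1 - eps) * (n%:R * (2 * c + 1)).
    by apply: mulr_ge0; [lra | apply: mulr_ge0 => //; lra].
  lra.
have wC1 x : w x - w x0 <= C1.
  have : M - w x0 <= C1.
    rewrite ler_pdivlMr ?exprn_gt0// mulrC.
    by have := gap n0 xm (leq_bigmax _); rewrite -/M; lra.
  by have := wM x; lra.
have D2s x : D2 x0 x <= \sum_x `|D2 x0 x|.
  rewrite (bigD1 x) //= (le_trans (ler_norm _))// lerDl.
  by apply: sumr_ge0.
have C10 : 0 <= C1.
  apply: divr_ge0; last exact: exprn_ge0 (ltW eps0).
  by apply: mulr_ge0 => //; rewrite /Cd; lra.
have D0 : 0 <= \sum_x `|D2 x0 x| by apply: sumr_ge0.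
move=> x; have := wC1 x; have := D2s x; have := wl x.
by rewrite ler_norml => *; apply/andP; split; lra.
Qed.

(** The third conclusion is not part of the equation: it comes from the coupling of the iterates,
    and later shows that no power split beats renewable-first. *)
Theorem average_cost_bellman : exists (theta : R) (V : S -> R),
  [/\ forall x a, a \in F -> theta + V x <= qvalue 1 V x a,
      forall x, exists2 a, a \in F & theta + V x = qvalue 1 V x a &
      forall x x', L2 x x' -> V x <= V x' + D2 x x'].
Proof.
(* The same sequence serves as [1 - alpha] and as the tolerance of the approximate fixed points. *)
pose e (m : nat) : R := m.+1%:R^-1.
have e0 m : 0 < e m by rewrite invr_gt0.
have e1 m : e m <= 1 by rewrite invf_le1 ?ler1n.
pose alpha m := 1 - e m.
have al0 m : 0 <= alpha m by rewrite subr_ge0.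
have al1 m : alpha m < 1 by rewrite ltrBlDr ltrDl.
have [C HC] := span_bound.
pose n m := projT1 (cid (approximate_fixpoint (al0 m) (al1 m) (e0 m))).
pose w m := value_iter (alpha m) (n m).
have [wle wge] : (forall m x a, a \in F -> w m x <= qvalue (alpha m) (w m) x a + e m) /\
  (forall m x, exists2 a, a \in F & qvalue (alpha m) (w m) x a <= w m x + e m).
  by split=> m; rewrite /w /n; case: cid => k /= [].
have wL2 m x x' : L2 x x' -> w m x <= w m x' + D2 x x'.
  by move=> L; apply: value_iter_coupling coupling2 L => //; apply: ltW.
(* The relative values and the normalised reference value stay bounded in [m], although [w m] itself
   may diverge. *)
pose h m x := w m x - w m x0.
pose th m := (1 - alpha m) * w m x0.
have hC m x : `|h m x| <= C.
  apply: (HC (alpha m) (w m)) => //.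
  - by rewrite al0 ltW.
  - by move=> y; apply: (value_iter_bound (al0 m) (al1 m) (n m)).
  - by move=> y a aF; apply: le_trans (wle m y a aF) _; rewrite lerD2l.
  - move=> y /L1x0 L; have := value_iter_coupling (al0 m) (al1 m) (n m) coupling1 L.
    by rewrite addr0.
  - by move=> y; apply: wL2.
have thc m : `|th m| <= c.
  rewrite normrM mulrC (@ger0_norm _ (1 - _)) ?subr_ge0 ?(ltW (al1 m))//.
  exact: (value_iter_bound (al0 m) (al1 m) (n m)).
have qh m x a : qvalue (alpha m) (w m) x a =
    qvalue (alpha m) (h m) x a + alpha m * w m x0.
  by rewrite /qvalue avgB (avg_cst mu_sum1); lra.
have [U UU sU] := ultra_finer_infty.
pose V x : R := lim (h ^~ x @ U).
pose theta : R := lim (th @ U).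
have hV x : h ^~ x @ U --> V x by apply: (ultra_bounded_cvg (M := C)).
have tht : th @ U --> theta by apply: (ultra_bounded_cvg (M := c)).
have eU : e @ U --> (0 : R).
  by apply: cvg_trans (@cvg_harmonic R); apply: cvg_app sU.
have alU : alpha @ U --> (1 : R).
  by rewrite -[1 in X in _ --> X]subr0; apply: cvgB => //; apply: cvg_cst.
have qV x a : (fun m => qvalue (alpha m) (h m) x a) @ U --> qvalue 1 V x a.
  apply: cvgD; first exact: cvg_cst.
  apply: cvgM => //; apply: cvg_sumr => z; apply: cvgM => //.
  exact: cvg_cst.
have lhs x : (fun m => th m + h m x) @ U --> theta + V x by apply: cvgD.
have le_q x a : a \in F -> theta + V x <= qvalue 1 V x a.
  move=> aF; rewrite -subr_ge0 -[X in 0 <= X - _]addr0.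
  have cv : (fun m => qvalue (alpha m) (h m) x a + e m - (th m + h m x)) @ U -->
      qvalue 1 V x a + 0 - (theta + V x) by apply: cvgB => //; apply: cvgD.
  apply: (cvgr_to_ge cv).
  apply: filterE => m /=; have := wle m x a aF.
  by rewrite qh; set q := qvalue _ (h m) x a; rewrite /th /h; lra.
exists theta, V; split=> //.
(* If no action attained equality, finiteness of the action set would make all the inequalities
   strict by more than [e m] for some [m], against the near-optimal action given by [wge]. *)
- move=> x; apply: contrapT => noa.
  have : \forall m \near U, forall a, a \in F ->
      th m + h m x + e m < qvalue (alpha m) (h m) x a.
    apply: filter_forall => a; case: (boolP (a \in F)) => aF; last exact: filterE.
    have lt_q : theta + V x + 0 < qvalue 1 V x a.
      rewrite addr0 lt_neqAle le_q// andbT; apply/eqP => E.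
      by apply: noa; exists a.
    have cv : (fun m => qvalue (alpha m) (h m) x a - (th m + h m x + e m)) @ U -->
        qvalue 1 V x a - (theta + V x + 0) by apply: cvgB => //; apply: cvgD.
    rewrite -subr_gt0 in lt_q; near=> m => _; rewrite -subr_gt0.
    by near: m; apply: cvgr_gt cv 0 lt_q.
  move=> /filter_ex[m Hm]; have [a aF] := wge m x; have := Hm a aF.
  by rewrite qh; set q := qvalue _ (h m) x a; rewrite /th /h; lra.
- move=> x x' L; rewrite -subr_ge0.
  have : (fun m => h m x' + D2 x x' - h m x) @ U --> V x' + D2 x x' - V x.
    by apply: cvgB => //; apply: cvgD => //; apply: cvg_cst.
  move=> /cvgr_to_ge; apply.
  by apply: filterE => m /=; have := wL2 m x x' L; rewrite /h; lra.
Unshelve. all: by end_near. Qed.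

End FiniteMDP.

(** * The noise of a slot *)

Section FiniteValued.
Context {R : realType} {d} {T : measurableType d} (P : probability T R).

Definition pr (A : set T) : R := fine (P A).

Lemma prE A : measurable A -> P A = (pr A)%:E.
Proof. by move=> mA; rewrite fineK// fin_num_measure. Qed.

Lemma pr_ge0 A : 0 <= pr A.
Proof. exact: fine_ge0. Qed.

Lemma expectation_simple (I : finType) (a : I -> R) (A : I -> set T) :
  (forall i, measurable (A i)) ->
  'E_P[fun x => (\sum_i a i * \1_(A i) x)%R]%E = (\sum_i a i * pr (A i))%:E.
Proof.
move=> mA; rewrite unlock.
have iA i : P.-integrable setT (fun x => (\1_(A i) x)%:E) by exact: integrable_indic.
under eq_integral do rewrite -sumEFin.
under eq_integral do under eq_bigr do rewrite EFinM.
rewrite integral_sum// => [|i]; last exact: integrableZl.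
rewrite -sumEFin; apply: eq_bigr => i _.
by rewrite integralZl// integral_indic// setIT EFinM; congr (_ * _)%E; exact: prE.
Qed.

Definition finite_rv {U : finType} (W : T -> U) : Prop :=
  forall u, measurable [set x | W x = u].

Lemma indic_sum {U : finType} (W : T -> U) (A : set T) x :
  \1_A x = \sum_u \1_(A `&` [set x | W x = u]) x :> R.
Proof.
rewrite (bigD1 (W x)) //= big1 ?addr0 => [|u uW].
  rewrite !indicE; congr (nat_of_bool _)%:R.
  by apply/idP/idP => /set_mem => [Ax|[Ax _]]; exact/mem_set.
by rewrite indicE memNset// => -[_] /= E; rewrite E eqxx in uW.
Qed.

Lemma pr_total {U : finType} (W : T -> U) (A : set T) :
  finite_rv W -> measurable A ->
  pr A = \sum_u pr (A `&` [set x | W x = u]).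
Proof.
move=> mW mA; apply: EFin_inj; rewrite -prE// -(expectation_indic P mA).
have -> : \1_A = fun x => \sum_u 1 * \1_(A `&` [set x | W x = u]) x :> R.
  by apply/funext => x; rewrite (indic_sum W); apply: eq_bigr => u _; rewrite mul1r.
rewrite (expectation_simple (fun=> 1)) => [|u]; last exact: measurableI.
by congr (_%:E); apply: eq_bigr => u _; rewrite mul1r.
Qed.

Lemma expectation_finite {U : finType} (W : T -> U) (G : U -> R) :
  finite_rv W ->
  'E_P[fun x => G (W x)]%E = (\sum_u G u * pr [set x | W x = u])%:E.
Proof.
move=> mW; rewrite -(expectation_simple G mW); congr ('E_P[_])%E.
apply/funext => x; rewrite (bigD1 (W x)) //= big1 => [|u uW].
  by rewrite indicE mem_set// mulr1 addr0.
by rewrite indicE memNset ?mulr0// => /= E; rewrite E eqxx in uW.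
Qed.

Lemma measurable_finite_rv {U : finType} (W : T -> U) (B : set U) :
  finite_rv W -> measurable (W @^-1` B).
Proof.
move=> mW; have -> : W @^-1` B = \bigcup_(u in B) [set x | W x = u].
  by apply/seteqP; split=> [x Bx|x [u Bu E]]; [exists (W x) | rewrite /preimage /= E].
by apply: fin_bigcup_measurable => //; exact: finite_finset.
Qed.

Lemma pr_finite_rv {U : finType} (W : T -> U) (B : pred U) :
  finite_rv W -> pr [set x | B (W x)] = \sum_(u | B u) pr [set x | W x = u].
Proof.
move=> mW; rewrite (pr_total mW); last exact: (measurable_finite_rv [set` B] mW).
rewrite [RHS]big_mkcond; apply: eq_bigr => u _; case: ifPn => Bu.
  by congr pr; apply/seteqP; split=> [x [] //|x /= E]; rewrite E.
set A := _ `&` _; have -> : A = set0; last by rewrite /pr measure0.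
by apply/seteqP; split=> x // [/= Bx E]; rewrite -E Bx in Bu.
Qed.

End FiniteValued.

(* Arrivals above the capacity of a queue are indistinguishable. *)
Notation slot_noise N := (fading N * data N * energy N)%type.

(** * Independent and identically distributed slots *)

Section Noise.
Context {R : realType} (N : network R) {d} {T : measurableType d}
  (P : probability T R) (X : exogenous N T).
Hypothesis HX : exogenous_ok P X.

Definition clip n (a : nat) : 'I_n.+1 := inord (minn a n).

Lemma clipE n a : clip n a = minn a n :> nat.
Proof. by rewrite inordK// ltnS geq_minr. Qed.

Definition noise_at t (x : T) : slot_noise N :=
  (fading_at X t x, [ffun k => clip (NQ N) (arrQ X k t x)],
   [ffun b => clip (NE N) (arrE X b t x)]).

Notation source := ('I_(nMS N) * 'I_(nBS N) + 'I_(nMS N) + 'I_(nBS N))%type.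

Definition source_event (t : nat) (z : slot_noise N) (j : source) : set T :=
  match j with
  | inl (inl (k, b)) => fade X k b t @^-1` [set z.1.1 (k, b)]
  | inl (inr k) => arrQ X k t @^-1` [set a | clip (NQ N) a = z.1.2 k]
  | inr b => arrE X b t @^-1` [set a | clip (NE N) a = z.2 b]
  end.

Lemma measurable_source_event t z j : measurable (source_event t z j).
Proof.
case: j => [[[k b]|k]|b].
- exact: (fade_rv HX).
- exact: (arrQ_rv HX).
- exact: (arrE_rv HX).
Qed.

Lemma source_event_id t z j : P (source_event t z j) = P (source_event 0 z j).
Proof.
case: j => [[[k b]|k]|b].
- exact: (fade_id HX).
- exact: (arrQ_id HX).
- exact: (arrE_id HX).
Qed.

Lemma noise_at_bigcap t z :
  [set x | noise_at t x = z] = \bigcap_(j in [set: source]) source_event t z j.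
Proof.
case: z => [[h aQ] aE]; apply/seteqP; split=> x /=.
  by move=> [<- <- <-] [[[k b]|k]|b] _ /=; rewrite ffunE.
move=> Hx; congr (_, _, _); apply/ffunP => i; rewrite ffunE.
- by case: i => k b; exact: (Hx (inl (inl (k, b)))).
- exact: (Hx (inl (inr i))).
- exact: (Hx (inr i)).
Qed.

Lemma noise_rv t : finite_rv (noise_at t).
Proof.
move=> z; rewrite noise_at_bigcap; apply: fin_bigcap_measurable.
  exact: finite_finset.
by move=> j _; exact: measurable_source_event.
Qed.

Definition source_prob (z : slot_noise N) (j : source) : R := pr P (source_event 0 z j).

Definition noise_prob (z : slot_noise N) : R := \prod_j source_prob z j.
Local Notation mu := noise_prob.

(** The cylinder is a finite intersection of events indexed by pairs of a slot and a source, which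
    independence factors; identical distribution then moves each factor to slot 0. *)
Lemma noise_cylinder n (z : nat -> slot_noise N) :
  pr P [set x | forall i, (i < n)%N -> noise_at i x = z i] = \prod_(i < n) mu (z i).
Proof.
pose s := [seq (i, j) | i <- iota 0 n, j <- enum {: source}].
pose J := [fset i in s]%fset.
have us : uniq s.
  by apply: allpairs_uniq; rewrite ?iota_uniq ?enum_uniq// => -[? ?] [? ?].
pose ev (i : nat * source) := source_event i.1 (z i.1) i.2.
have evE : [set x | forall i, (i < n)%N -> noise_at i x = z i] =
    \bigcap_(i in [set` J]) ev i.
  apply/seteqP; split=> x /= Hx.
    move=> [i j] /=; rewrite !inE /= => /allpairsP[[i' j'] [/= ii' _ [-> ->]]].
    have : [set x | noise_at i' x = z i'] x by apply: Hx; rewrite mem_iota in ii'.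
    by rewrite noise_at_bigcap; apply.
  move=> i ni; have : [set x | noise_at i x = z i] x; last by [].
  rewrite noise_at_bigcap => j _; apply: (Hx (i, j)).
  by rewrite /= !inE; apply/allpairsP; exists (i, j); rewrite mem_iota mem_enum.
rewrite evE /pr (sources_indep HX (A := ev)) => [|[i j] _]; last first.
  by case: j => [[[k b]|k]|b] /=; eexists; reflexivity.
have -> : (\prod_(i <- J) P (ev i))%E = (\prod_(i <- s) P (ev i))%E.
  apply: perm_big; apply: uniq_perm; rewrite ?fset_uniq// => i.
  by rewrite in_fset.
have -> : (\prod_(i <- s) P (ev i))%E = (\prod_(i <- s) source_prob (z i.1) i.2)%:E.
  rewrite -prodEFin; apply: eq_bigr => i _.
  by rewrite source_event_id prE//; exact: measurable_source_event.
rewrite /= big_allpairs -(big_mkord xpredT (fun i => mu (z i))) /index_iota subn0.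
by apply: eq_bigr => i _; rewrite /noise_prob big_enum.
Qed.

Lemma pr_noise0 z : pr P [set x | noise_at 0 x = z] = mu z.
Proof.
have := noise_cylinder 1 (fun=> z); rewrite big_ord1 => <-; congr pr.
by apply/seteqP; split=> x /= => [E [|i]//|]; apply.
Qed.

Lemma noise_prob_ge0 z : 0 <= mu z.
Proof. by apply: prodr_ge0 => j _; exact: pr_ge0. Qed.

Lemma noise_prob_sum1 : \sum_z mu z = 1.
Proof.
under eq_bigr do rewrite -pr_noise0.
rewrite -(@pr_finite_rv _ _ _ P _ (noise_at 0) xpredT); last exact: noise_rv.
by rewrite /pr (_ : [set x | _] = setT) ?probability_setT//; exact/seteqP.
Qed.

Definition history t (x : T) : {ffun 'I_t -> slot_noise N} :=
  [ffun i : 'I_t => noise_at i x].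

Lemma history_rv t : finite_rv (history t).
Proof.
move=> w; have -> : [set x | history t x = w] =
    \bigcap_(i in [set: 'I_t]) [set x | noise_at i x = w i].
  apply/seteqP; split=> x /= => [<- i _ /=|Hx]; first by rewrite ffunE.
  by apply/ffunP => i; rewrite ffunE; exact: Hx.
apply: fin_bigcap_measurable; first exact: finite_finset.
by move=> i _; exact: noise_rv.
Qed.

Lemma pr_history_noise t w z :
  pr P ([set x | history t x = w] `&` [set x | noise_at t x = z]) =
  pr P [set x | history t x = w] * mu z.
Proof.
(* The history [w] extended to all indices; the value from [t] on is an arbitrary filler. *)
pose zw i := if insub i is Some j then w j else noise_at 0 point.
pose zs i := if i == t then z else zw i.
have zwE (i : 'I_t) : zw i = w i.
  by rewrite /zw insubT// => it; congr (w _); exact/val_inj.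
have histE : [set x | history t x = w] =
    [set x | forall i, (i < t)%N -> noise_at i x = zw i].
  apply/seteqP; split=> x /= => [E i it|Hx].
    by rewrite -[i]/(val (Ordinal it)) zwE -E ffunE.
  by apply/ffunP => i; rewrite ffunE Hx// zwE.
have -> : [set x | history t x = w] `&` [set x | noise_at t x = z] =
    [set x | forall i, (i < t.+1)%N -> noise_at i x = zs i].
  rewrite histE; apply/seteqP; split=> x /= => [[Hx Hz] i|Hx].
    by rewrite ltnS leq_eqVlt /zs; case: eqVneq => [->|_ /Hx].
  split=> [i it|]; last by rewrite (Hx t)// /zs eqxx.
  by rewrite Hx ?ltnS ?(ltnW it)// /zs ltn_eqF.
rewrite histE !noise_cylinder big_ord_recr /= {2}/zs eqxx; congr (_ * _).
by apply: eq_bigr => i _; rewrite /zs ltn_eqF.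
Qed.

Definition determined_before t (A : set T) : Prop :=
  forall x x', (forall i, (i < t)%N -> noise_at i x = noise_at i x') -> A x -> A x'.

(** On each fibre of the history [A] is all or nothing, so the sum over histories reduces to the
    product rule [pr_history_noise]. *)
Lemma pr_indep_noise t (A : set T) z : measurable A -> determined_before t A ->
  pr P (A `&` [set x | noise_at t x = z]) = pr P A * mu z.
Proof.
move=> mA dA; rewrite (pr_total _ (@history_rv t) mA).
rewrite (pr_total _ (@history_rv t)); last exact: measurableI _ _ mA (@noise_rv t z).
rewrite mulr_suml; apply: eq_bigr => w _.
have sameH x x' : history t x = w -> history t x' = w -> A x -> A x'.
  move=> xw x'w; apply: dA => i it.
  have := congr1 (fun f : {ffun 'I_t -> slot_noise N} => f (Ordinal it))
    (etrans xw (esym x'w)).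
  by rewrite !ffunE.
have [[x0 [x0w Ax0]]|noA] := pselect (exists x, history t x = w /\ A x).
  rewrite setIAC (_ : A `&` _ = [set x | history t x = w]) ?pr_history_noise//.
  apply/seteqP; split=> x /= => [[]//|xw]; split=> //.
  exact: sameH x0w xw Ax0.
have noA' : A `&` [set x | history t x = w] = set0.
  by apply/seteqP; split=> x // [Ax xw]; apply: noA; exists x.
by rewrite setIAC noA' set0I /pr measure0 mul0r.
Qed.

Definition with_csi_noise (H : csi N) (z : slot_noise N) : slot_noise N :=
  (with_csi H z.1.1, z.1.2, z.2).

Lemma csi_of_with_csi (H : csi N) h : csi_of (with_csi H h) = H.
Proof. by apply/ffunP => k; rewrite !ffunE /= eqxx. Qed.

Lemma with_csiK (H : csi N) h : with_csi (csi_of h) (with_csi H h) = h.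
Proof.
by apply/ffunP => -[k b]; rewrite !ffunE /=; case: eqP => // ->.
Qed.

Lemma source_prob_with_csi (z z' : slot_noise N) j :
  source_prob (with_csi_noise (csi_of z.1.1) z') j =
  if j is inl (inl (k, b)) then
    if b == assoc k then source_prob z j else source_prob z' j
  else source_prob z' j.
Proof.
by case: j => [[[k b]|k]|b] //; rewrite /source_prob /= !ffunE /=; case: eqP => // ->.
Qed.

(** [mu] is a product over sources, and on both sides each source contributes the same two factors;
    for a direct link they are merely exchanged. *)
Lemma noise_prob_swap_csi (z z' : slot_noise N) :
  mu (with_csi_noise (csi_of z.1.1) z') * mu (with_csi_noise (csi_of z'.1.1) z) =
  mu z' * mu z.
Proof.
rewrite -!big_split; apply: eq_bigr => j _ /=; rewrite !source_prob_with_csi.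
by case: j => [[[k b]|k]|b] //; case: ifP => // _; rewrite mulrC.
Qed.

(* Exchanging the direct links of two independent slots preserves their joint
   law. *)
Lemma avg_resampled_csi (G : slot_noise N -> R) :
  \sum_z' mu z' * avg mu (fun z => G (with_csi_noise (csi_of z'.1.1) z)) = avg mu G.
Proof.
pose swap (zz : slot_noise N * slot_noise N) :=
  (with_csi_noise (csi_of zz.2.1.1) zz.1, with_csi_noise (csi_of zz.1.1.1) zz.2).
have swapK : involutive swap.
  move=> [[[h a] e] [[h' a'] e']]; rewrite /swap /with_csi_noise /=.
  by rewrite !csi_of_with_csi !with_csiK.
transitivity (\sum_zz mu zz.1 * mu zz.2 * G (swap (zz.1, zz.2)).2).
  rewrite -(pair_bigA _ (fun z' z => mu z' * mu z * G (swap (z', z)).2)) /=.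
  by apply: eq_bigr => z' _; rewrite mulr_sumr; apply: eq_bigr => z _; rewrite mulrA.
under eq_bigr do rewrite -surjective_pairing.
rewrite (reindex_inj (inv_inj swapK)).
under eq_bigr do rewrite swapK /= noise_prob_swap_csi.
rewrite -(pair_bigA _ (fun z' z => mu z' * mu z * G z)) /= /avg.
transitivity (\sum_z' mu z' * avg mu G).
  by apply: eq_bigr => z' _; rewrite mulr_sumr; apply: eq_bigr => z _; rewrite mulrA.
by rewrite -mulr_suml noise_prob_sum1 mul1r.
Qed.

End Noise.

(** * Time averages and upper limits *)

Section TimeAverages.
Context {R : realType}.

Lemma cvg_natV : (fun n => n%:R^-1 : R) @ \oo --> (0 : R).
Proof. by rewrite -cvg_shiftS; exact: cvg_harmonic. Qed.

Lemma cesaro_cvg (u : nat -> R) (l C : R) :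
  (forall n, `|\sum_(t < n) u t - n%:R * l| <= C) ->
  (fun n => n%:R^-1 * \sum_(t < n) u t) @ \oo --> l.
Proof.
move=> uC; have cvC s : (fun n : nat => l + s * (C * n%:R^-1)) @ \oo --> l.
  rewrite [X in _ --> X](_ : l = l + s * (C * 0)); last by rewrite !mulr0 addr0.
  apply: cvgD; first exact: cvg_cst.
  apply: cvgM; first exact: cvg_cst.
  by apply: cvgM; [exact: cvg_cst | exact: cvg_natV].
apply: (squeeze_cvgr _ (cvC (-1)) (cvC 1)); exists 1%N => // n /= n1.
have n0 : 0 < n%:R :> R by rewrite ltr0n.
have -> : n%:R^-1 * \sum_(t < n) u t = l + (\sum_(t < n) u t - n%:R * l) * n%:R^-1.
  by field; rewrite gt_eqF.
have := uC n; rewrite ler_norml => /andP[h1 h2].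
by rewrite mulN1r mul1r !lerD2l -mulNr !ler_pM2r ?invr_gt0// h1 h2.
Qed.

Lemma limn_esup_cvg (u : nat -> R) (l : R) :
  u @ \oo --> l -> limn_esup (EFin \o u) = l%:E.
Proof.
move=> ul; apply: (cvg_limn_einf_sup _).2; apply/fine_cvgP; split=> //.
exact: filterE.
Qed.

(** Along a single ultrafilter all component averages converge at once, so their weighted limits add
    up to at least [theta]; each upper limit dominates the corresponding ultrafilter limit. *)
Lemma weighted_limsup_ge (I : finType) (w : I -> R) (a : I -> nat -> R)
    (M : I -> R) (theta C : R) :
  (forall i, 0 <= w i) -> (forall i n, `|a i n| <= M i) ->
  (forall n, (0 < n)%N -> theta - C * n%:R^-1 <= \sum_i w i * a i n) ->
  (theta%:E <= \sum_i (w i)%:E * limn_esup (EFin \o a i))%E.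
Proof.
move=> w0 aM ha; have [U UU sU] := ultra_finer_infty.
have al i : a i @ U --> lim (a i @ U) by exact: ultra_bounded_cvg UU (aM i).
have cv : (fun n => \sum_i w i * a i n + C * n%:R^-1) @ U -->
    \sum_i w i * lim (a i @ U) + C * 0.
  apply: cvgD; first by apply: cvg_sumr => i; apply: cvgM => //; exact: cvg_cst.
  apply: cvgM; first exact: cvg_cst.
  by apply: cvg_trans cvg_natV; exact: cvg_app sU.
have : theta <= \sum_i w i * lim (a i @ U).
  rewrite mulr0 addr0 in cv; apply: (cvgr_to_ge cv); apply: sU.
  by exists 1%N => // n /= n1; rewrite -lerBlDr; exact: ha.
rewrite -lee_fin => /le_trans; apply; rewrite -sumEFin; apply: lee_sum => i _.
by rewrite EFinM lee_wpmul2l ?lee_fin//; exact: limn_esup_ge_ultra.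
Qed.

End TimeAverages.

(** * The controlled process *)

Section Trajectory.
Context {R : realType} (N : network R) {d} {T : measurableType d}
  (P : probability T R) (X : exogenous N T).
Hypothesis HX : exogenous_ok P X.

Local Notation mu := (noise_prob P X).
Local Notation pr := (pr P).

Definition slot_step (x : qstate N) (pE p : dtx N) (s : csi N -> sched N)
    (z : slot_noise N) : qstate N :=
  (next_energy x.1 pE (fun b => z.2 b),
   next_data x.2 z.1.1 p (s (csi_of z.1.1)) (fun k => z.1.2 k)).

Definition paction_step (x : qstate N) (a : paction N) (z : slot_noise N) : qstate N :=
  slot_step x (renewable_part x.1 (act_p a)) (act_p a) (act_s a) z.

Definition policy_step (pi : policy N) t (x : qstate N) (z : slot_noise N) : qstate N :=
  slot_step x (pol_pE pi t x.1 x.2) (pol_p pi t x.1 x.2) (pol_s pi t x.1 x.2) z.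

Lemma next_energy_clip E (pE : dtx N) (a : 'I_(nBS N) -> nat) :
  next_energy E pE (fun b => clip (NE N) (a b)) = next_energy E pE a.
Proof. by apply/ffunP => b; rewrite !ffunE clipE; congr inord; lia. Qed.

Lemma next_data_clip Q h p s (a : 'I_(nMS N) -> nat) :
  next_data Q h p s (fun k => clip (NQ N) (a k)) = next_data Q h p s a.
Proof. by apply/ffunP => k; rewrite !ffunE clipE; congr inord; lia. Qed.

Lemma slot_stepE x pE p s h t (w : T) :
  slot_step x pE p s
    (h, [ffun k => clip (NQ N) (arrQ X k t w)], [ffun b => clip (NE N) (arrE X b t w)]) =
  (next_energy x.1 pE (fun b => arrE X b t w),
   next_data x.2 h p (s (csi_of h)) (fun k => arrQ X k t w)).
Proof.
rewrite /slot_step /=; congr pair.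
  by rewrite -[RHS]next_energy_clip; apply/ffunP => b; rewrite !ffunE.
by rewrite -[RHS]next_data_clip; apply/ffunP => b; rewrite !ffunE.
Qed.

Lemma pr_noise_pred (B : pred (slot_noise N)) :
  pr [set x | B (noise_at X 0 x)] = \sum_(z | B z) mu z.
Proof.
rewrite (pr_finite_rv _ _ (@noise_rv _ _ _ _ _ _ HX 0)).
by apply: eq_bigr => z _; exact: pr_noise0.
Qed.

Lemma csi_probE H : csi_prob P X H = (\sum_(z | csi_of z.1.1 == H) mu z)%:E.
Proof.
rewrite -pr_noise_pred -prE.
  by congr (P _); apply/seteqP; split=> x /eqP.
exact: (measurable_finite_rv [set z : slot_noise N | csi_of z.1.1 == H]
  (@noise_rv _ _ _ _ _ _ HX 0)).
Qed.

Lemma full_kernelE E Q H p s y : full_kernel P X E Q H p s y =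
  \sum_(z | slot_step (E, Q) (renewable_part E p) p (fun=> s)
              (with_csi_noise H z) == y) mu z.
Proof.
rewrite -pr_noise_pred; congr pr; apply/seteqP; split=> x /=.
  by move=> <-; rewrite /with_csi_noise slot_stepE.
by move=> /eqP <-; rewrite /with_csi_noise slot_stepE.
Qed.

(** The kernel draws the CSI and then, independently, the remaining links and the arrivals;
    [avg_resampled_csi] identifies this two-stage draw with the noise of one slot. *)
Lemma mean_kernelE E Q a y : mean_kernel P X E Q a y =
  avg mu (fun z => (paction_step (E, Q) a z == y)%:R).
Proof.
rewrite -(avg_resampled_csi HX).
rewrite (partition_big (fun z' : slot_noise N => csi_of z'.1.1) xpredT) //=.
apply: eq_bigr => H _; rewrite csi_probE /= mulr_suml.
apply: eq_bigr => z' /eqP ->; congr (_ * _).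
rewrite full_kernelE big_mkcond; apply: eq_bigr => z _.
rewrite /paction_step /slot_step /= csi_of_with_csi.
by case: ifP => _; rewrite ?mulr1 ?mulr0.
Qed.

Lemma bellman_rhsE V E Q a : bellman_rhs P X V E Q a =
  stage_cost E Q a +
  avg mu (fun z => let y := paction_step (E, Q) a z in V y.1 y.2).
Proof.
rewrite /bellman_rhs; congr (_ + _).
under eq_bigr do rewrite mean_kernelE mulr_suml.
rewrite exchange_big; apply: eq_bigr => z _ /=.
rewrite (bigD1 (paction_step (E, Q) a z)) //= big1 => [|y yz].
  by rewrite eqxx mulr1 addr0.
by rewrite eq_sym (negPf yz) mulr0 mul0r.
Qed.

Section Law.
Variables (pi : policy N) (x1 : qstate N) (H1 : csi N).
Local Notation traj := (trajectory X pi x1 H1).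

Lemma trajectoryS t (w : T) : traj t.+1 w =
  policy_step pi t (traj t w)
    (if t is 0%N then with_csi_noise H1 (noise_at X 0 w) else noise_at X t w).
Proof.
rewrite /=; case: (traj t w) => E Q; rewrite /policy_step.
by case: t => [|t]; rewrite slot_stepE.
Qed.

Lemma trajectory_determined t (w w' : T) :
  (forall i, (i < t)%N -> noise_at X i w = noise_at X i w') -> traj t w = traj t w'.
Proof.
elim: t => [//|t IH] ww'; rewrite !trajectoryS IH => [|i it]; last exact/ww'/ltnW.
by case: t IH ww' => [|t] _ ww'; rewrite ww'.
Qed.

Lemma trajectory_rv t : finite_rv (traj t).
Proof.
move=> s.
have -> : [set w | traj t w = s] =
    history X t @^-1` [set v | exists2 w, history X t w = v & traj t w = s].
  apply/seteqP; split=> w /= => [ws|[w' ww' <-]]; first by exists w.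
  apply: trajectory_determined => i it.
  have := congr1 (fun f : {ffun 'I_t -> slot_noise N} => f (Ordinal it)) ww'.
  by rewrite !ffunE.
by apply: measurable_finite_rv; exact: (history_rv HX).
Qed.

Definition trajectory_law t (s : qstate N) : R := pr [set w | traj t w = s].
Local Notation law := trajectory_law.

Definition trajectory_mean t (F : qstate N -> R) : R := \sum_s law t s * F s.
Local Notation mean := trajectory_mean.

Lemma trajectory_law_ge0 t s : 0 <= law t s. Proof. exact: pr_ge0. Qed.

Lemma trajectory_law_sum1 t : \sum_s law t s = 1.
Proof.
rewrite -(pr_finite_rv P xpredT (@trajectory_rv t)) /pr.
by rewrite (_ : [set x | _] = setT) ?probability_setT//; exact/seteqP.
Qed.

(** The state entering a slot depends on earlier noise only, hence is independent of the noise of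
    that slot. The statement starts at slot index 1 because at index 0 the direct links are imposed
    by [H1]. *)
Lemma trajectory_meanS t F :
  mean t.+2 F = mean t.+1 (fun s => avg mu (fun z => F (policy_step pi t.+1 s z))).
Proof.
pose W w := (traj t.+1 w, noise_at X t.+1 w).
have mW : finite_rv W.
  move=> [s z]; have -> : [set w | W w = (s, z)] =
      [set w | traj t.+1 w = s] `&` [set w | noise_at X t.+1 w = z].
    by apply/seteqP; split=> w /= => [[-> ->]|[<- <-]].
  by apply: measurableI; [exact: trajectory_rv | exact: (noise_rv HX)].
apply: EFin_inj; rewrite /trajectory_mean; under eq_bigr do rewrite mulrC.
rewrite -(expectation_finite _ F (@trajectory_rv t.+2)).
pose G (u : qstate N * slot_noise N) := F (policy_step pi t.+1 u.1 u.2).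
rewrite (_ : (fun w => F (traj t.+2 w)) = fun w => G (W w)); last first.
  by apply/funext => w; rewrite trajectoryS.
rewrite (expectation_finite P G mW); congr EFin.
under [RHS]eq_bigr do rewrite mulr_sumr.
rewrite pair_bigA; apply: eq_bigr => -[s z] _ /=.
have -> : [set w | W w = (s, z)] =
    [set w | traj t.+1 w = s] `&` [set w | noise_at X t.+1 w = z].
  by apply/seteqP; split=> w /= => [[-> ->]|[<- <-]].
rewrite (pr_indep_noise HX); first by rewrite mulrC mulrA.
  exact: trajectory_rv.
by move=> w w' ww' <-; apply: trajectory_determined => i it; rewrite ww'.
Qed.

Lemma time_averageE (F : nat -> qstate N -> R) :
  time_average P (fun t w => F t (traj t w)) =
  limn_esup (EFin \o (fun n => n%:R^-1 * \sum_(t < n) mean t (F t))).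
Proof.
rewrite /time_average; congr limn_esup; apply/funext => n /=.
rewrite EFinM; congr (_ * _)%E.
pose A (i : 'I_n * qstate N) := [set w | traj i.1 w = i.2].
transitivity ('E_P[fun w => (\sum_(i : 'I_n * qstate N) F i.1 i.2 * \1_(A i) w)%R])%E.
  congr ('E_P[_])%E; apply/funext => w.
  rewrite -(pair_bigA _ (fun (t : 'I_n) s => F t s * \1_(A (t, s)) w)) /=.
  apply: eq_bigr => t _; rewrite (bigD1 (traj t w)) //= big1 => [|s sw].
    by rewrite indicE mem_set// mulr1 addr0.
  by rewrite indicE memNset ?mulr0// => /= E; rewrite /A /= E eqxx in sw.
rewrite (expectation_simple P (fun i : 'I_n * qstate N => F i.1 i.2)); last first.
  by move=> i; exact: trajectory_rv.
rewrite -(pair_bigA _ (fun (t : 'I_n) s => F t s * pr (A (t, s)))) /=; congr EFin.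
by apply: eq_bigr => t _; apply: eq_bigr => s _; rewrite mulrC.
Qed.

End Law.
End Trajectory.

Lemma le_sum_norm {R : realType} {S : finType} (F : S -> R) s :
  `|F s| <= \sum_x `|F x|.
Proof. by rewrite (bigD1 s) //= lerDl; exact: sumr_ge0. Qed.

(** * Long-run averages along a trajectory *)

Section LongRun.
Context {R : realType} (N : network R) {d} {T : measurableType d}
  (P : probability T R) (X : exogenous N T).
Hypothesis HX : exogenous_ok P X.
Variables (pi : policy N) (x1 : qstate N) (H1 : csi N).

Local Notation mu := (noise_prob P X).
Local Notation mean := (trajectory_mean P X pi x1 H1).
Local Notation S := (qstate N).

Let law_ge0 t s := trajectory_law_ge0 P X pi x1 H1 t s.
Let law_sum1 t := trajectory_law_sum1 HX pi x1 H1 t.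

Lemma norm_mean_le t F M : (forall s, `|F s| <= M) -> `|mean t F| <= M.
Proof. by move=> FM; apply: (norm_avg_le (law_ge0 t) (law_sum1 t)). Qed.

(** Averaging the inequality along the trajectory and summing telescopes the terms in [V]; slot
    index 0, which the hypothesis leaves out, goes into the constant. *)
Lemma sum_mean_ge (c : nat -> S -> R) V theta :
  (forall t s, theta + V s <=
     c t.+1 s + avg mu (fun z => V (policy_step pi t.+1 s z))) ->
  exists C, forall n, n%:R * theta - C <= \sum_(t < n) mean t (c t).
Proof.
move=> cV.
have low n : n%:R * theta + mean 1 V - mean n.+1 V + mean 0 (c 0%N) <=
    \sum_(t < n.+1) mean t (c t).
  elim: n => [|n IH]; first by rewrite big_ord1 /=; lra.
  rewrite big_ord_recr /=.
  have : theta + mean n.+1 V <= mean n.+1 (c n.+1) + mean n.+2 V.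
    rewrite (trajectory_meanS HX) -[theta](avg_cst (law_sum1 n.+1)) /trajectory_mean.
    rewrite -!/(avg (trajectory_law P X pi x1 H1 n.+1) _) -!avgD.
    by apply: (le_avg (law_ge0 n.+1)).
  by rewrite -natr1; lra.
pose C := `|theta| + 2 * (\sum_s `|V s|) + `|mean 0 (c 0%N)|.
have V_ge0 : 0 <= \sum_s `|V s| by apply: sumr_ge0.
have th0 : - theta <= `|theta| /\ theta <= `|theta|.
  by rewrite -{1}normrN !ler_norm.
have c0 : - mean 0 (c 0%N) <= `|mean 0 (c 0%N)| by rewrite -normrN ler_norm.
exists C => -[|n]; rewrite /C.
  rewrite big_ord0; have := normr_ge0 theta; have := normr_ge0 (mean 0 (c 0%N)).
  by lra.
have V1 := norm_mean_le 1 (le_sum_norm V).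
have Vn := norm_mean_le n.+1 (le_sum_norm V).
rewrite ler_norml in V1; rewrite ler_norml in Vn.
case/andP: V1 => V1 _; case/andP: Vn => _ Vn.
by have := low n; rewrite -natr1; lra.
Qed.

Lemma sum_mean_eq (c : nat -> S -> R) V theta :
  (forall t s, theta + V s =
     c t.+1 s + avg mu (fun z => V (policy_step pi t.+1 s z))) ->
  exists C, forall n, `|\sum_(t < n) mean t (c t) - n%:R * theta| <= C.
Proof.
move=> cV.
have [C1 H1'] : exists C, forall n, n%:R * theta - C <= \sum_(t < n) mean t (c t).
  by apply: (@sum_mean_ge c V) => t s; rewrite (cV t s).
have [C2 H2] : exists C, forall n,
    n%:R * (- theta) - C <= \sum_(t < n) mean t (fun s => - c t s).
  apply: (@sum_mean_ge (fun t s => - c t s) (fun s => - V s)) => t s.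
  rewrite -opprD (cV t s) opprD /avg; under [X in _ <= _ + X]eq_bigr do rewrite mulrN.
  by rewrite sumrN.
exists (`|C1| + `|C2|) => n.
have := H1' n; have := H2 n.
have -> : \sum_(t < n) mean t (fun s => - c t s) = - \sum_(t < n) mean t (c t).
  rewrite -sumrN; apply: eq_bigr => t _; rewrite /trajectory_mean -sumrN.
  by apply: eq_bigr => s _; rewrite mulrN.
have := ler_norm C1; have := ler_norm C2.
have := normr_ge0 C1; have := normr_ge0 C2.
by rewrite ler_norml => *; apply/andP; split; lra.
Qed.

(** In the decomposition [F = u + w - K w] the coboundary telescopes and stays bounded, while the
    mean of the invariant part [u] is constant from slot index 1 on. The limit is that constant,
    which may depend on the initial state. *)
Lemma sum_mean_homogeneous (F : S -> R) :
  (forall t s z, policy_step pi t s z = policy_step pi 0 s z) ->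
  exists l C, forall n, `|\sum_(t < n) mean t F - n%:R * l| <= C.
Proof.
move=> hom; pose k s y := avg mu (fun z => (policy_step pi 0 s z == y)%:R).
have kE f s : \sum_y k s y * f y = avg mu (fun z => f (policy_step pi 0 s z)).
  rewrite /k /avg; under eq_bigr do rewrite mulr_suml.
  rewrite exchange_big; apply: eq_bigr => z _ /=.
  rewrite (bigD1 (policy_step pi 0 s z)) //= big1 => [|y yz].
    by rewrite eqxx mulr1 addr0.
  by rewrite eq_sym (negPf yz) mulr0 mul0r.
have k_ge0 s y : 0 <= k s y.
  by apply: sumr_ge0 => z _; rewrite mulr_ge0 ?noise_prob_ge0.
have k_sum1 s : \sum_y k s y = 1.
  have := kE (fun=> 1) s; rewrite (avg_cst (noise_prob_sum1 HX)) => <-.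
  by apply: eq_bigr => y _; rewrite mulr1.
have [u [w [uK Fuw]]] := poisson_decomposition k_ge0 k_sum1 F.
have [C HC] : exists C, forall n,
    `|\sum_(t < n) mean t (fun s => F s - u s) - n%:R * 0| <= C.
  apply: (@sum_mean_eq (fun _ s => F s - u s) w) => t s.
  under eq_fun do rewrite hom.
  by rewrite -kE Fuw; lra.
have u1 t : mean t.+1 u = mean 1 u.
  elim: t => // t <-; rewrite (trajectory_meanS HX); apply: eq_bigr => s _; congr (_ * _).
  by rewrite -uK kE; apply: eq_bigr => z _; rewrite hom.
(* Index 0 is the only one at which the mean of [u] may differ, whence the second constant. *)
exists (mean 1 u), (C + `|mean 0 u - mean 1 u|) => n.
have -> : \sum_(t < n) mean t F - n%:R * mean 1 u =
    (\sum_(t < n) mean t (fun s => F s - u s) - n%:R * 0) +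
    (if n is 0 then 0 else mean 0 u - mean 1 u).
  have -> : \sum_(t < n) mean t (fun s => F s - u s) =
      \sum_(t < n) mean t F - \sum_(t < n) mean t u.
    rewrite -sumrB; apply: eq_bigr => t _.
    exact: (avgB (trajectory_law P X pi x1 H1 t) F u).
  case: n => [|n]; first by rewrite !big_ord0; lra.
  rewrite [in X in _ = _ - X - _ + _]big_ord_recl /=.
  under [in X in _ = _ - X - _ + _]eq_bigr do rewrite /bump /= u1.
  by rewrite sumr_const card_ord -[_ *+ n]mulr_natl -natr1; lra.
apply: (le_trans (ler_normD _ _)); apply: lerD; first exact: HC.
by case: n => [|n] //; rewrite normr0.
Qed.

(** One index type for data queues and grid powers turns the objective into a single weighted sum of
    upper limits. *)
Notation component := ('I_(nMS N) + 'I_(nBS N))%type.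

Definition component_weight (i : component) : R :=
  match i with inl k => weightQ k | inr b => weightE b end.

Definition component_cost t (i : component) (s : S) : R :=
  match i with
  | inl k => fcost N (s.2 k)
  | inr b => (pol_pG pi t s.1 s.2 b)%:R
  end.

(** Unlike [stage_cost], this charges the grid power that the policy really draws, not that of the
    renewable-first split. *)
Definition slot_cost t (s : S) : R :=
  \sum_i component_weight i * component_cost t i s.

Definition component_average i n : R :=
  n%:R^-1 * \sum_(t < n) mean t (component_cost t i).

Lemma average_costE : average_cost P X pi x1 H1 =
  (\sum_i (component_weight i)%:E * limn_esup (EFin \o component_average i))%E.
Proof.
rewrite big_sumType /average_cost; congr (_ + _)%E; apply: eq_bigr => i _ /=;
  congr (_ * _)%E.
- by rewrite (time_averageE HX pi x1 H1 (fun t => component_cost t (inl i))).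
- rewrite -(time_averageE HX pi x1 H1 (fun t => component_cost t (inr i))).
  by congr time_average; apply/funext => t; apply/funext => x; case: trajectory.
Qed.

Lemma sum_slot_cost n : n%:R^-1 * \sum_(t < n) mean t (slot_cost t) =
  \sum_i component_weight i * component_average i n.
Proof.
under [RHS]eq_bigr do rewrite mulrCA.
rewrite -mulr_sumr; congr (_ * _).
under [RHS]eq_bigr do rewrite mulr_sumr.
rewrite [RHS]exchange_big; apply: eq_bigr => t _ /=.
under [RHS]eq_bigr do rewrite mulr_sumr.
rewrite [RHS]exchange_big; apply: eq_bigr => s _ /=.
by rewrite mulr_sumr; apply: eq_bigr => i _; rewrite mulrCA.
Qed.

Lemma component_average_bounded i :
  exists M, forall n, `|component_average i n| <= M.
Proof.
have [M HM] : exists M, forall t s, `|component_cost t i s| <= M.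
  case: i => [k|b]; last first.
    by exists 1 => t s /=; case: (pol_pG _ _ _ _ _); rewrite ?normr1 ?normr0.
  exists (\sum_(s : S) `|fcost N (s.2 k)|) => _ s /=.
  exact: (le_sum_norm (fun s : S => _)).
exists M => -[|n].
  by rewrite /component_average invr0 mul0r normr0 (le_trans _ (HM 0%N x1)).
rewrite /component_average normrM ger0_norm// mulrC ler_pdivrMr ?ltr0n//.
apply: (le_trans (ler_norm_sum _ _ _)).
apply: (@le_trans _ _ (\sum_(t < n.+1) M)).
  by apply: ler_sum => t _; apply: norm_mean_le.
by rewrite sumr_const card_ord mulr_natr.
Qed.

Lemma average_cost_ge theta V : (forall i, 0 <= component_weight i) ->
  (forall t s, theta + V s <=
     slot_cost t.+1 s + avg mu (fun z => V (policy_step pi t.+1 s z))) ->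
  (theta%:E <= average_cost P X pi x1 H1)%E.
Proof.
move=> w0 /sum_mean_ge[C HC]; rewrite average_costE.
apply: (weighted_limsup_ge (C := C) w0
  (fun i => projT2 (cid (component_average_bounded i)))) => n n0.
have nR : 0 < n%:R :> R by rewrite ltr0n.
rewrite -sum_slot_cost ler_pdivlMl//.
have -> : n%:R * (theta - C * n%:R^-1) = n%:R * theta - C.
  by field; rewrite gt_eqF.
exact: HC.
Qed.

(** Time-homogeneity makes each component average converge, so the upper limits add up to the limit
    of the averaged slot cost; telescoping the equation shows that this limit is [theta]. *)
Lemma average_cost_eq theta V :
  (forall t s z, policy_step pi t s z = policy_step pi 0 s z) ->
  (forall t i s, component_cost t i s = component_cost 0 i s) ->
  (forall t s, theta + V s =
     slot_cost t.+1 s + avg mu (fun z => V (policy_step pi t.+1 s z))) ->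
  average_cost P X pi x1 H1 = theta%:E.
Proof.
move=> hom cst /sum_mean_eq[C HC].
have cv_theta := @cesaro_cvg R (fun t => mean t (slot_cost t)) theta C HC.
have [l Hl] : {l : component -> R & forall i, component_average i @ \oo --> l i}.
  apply: (choice (P := fun i (l : R) => component_average i @ \oo --> l)).
  move=> i; have [l [C' HC']] := sum_mean_homogeneous (component_cost 0 i) hom.
  exists l; apply: (@cesaro_cvg R (fun t => mean t (component_cost t i)) l C') => n.
  rewrite (eq_bigr (fun t : 'I_n => mean t (component_cost 0 i))) => [|t _].
    exact: HC'.
  by congr (trajectory_mean _ _ _ _ _ _ _); apply/funext => s; exact: cst.
have cv_l : (fun n => n%:R^-1 * \sum_(t < n) mean t (slot_cost t)) @ \oo -->
    \sum_i component_weight i * l i.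
  under eq_fun do rewrite sum_slot_cost.
  by apply: cvg_sumr => i; apply: cvgM; [exact: cvg_cst | exact: Hl].
rewrite average_costE; under eq_bigr do rewrite (limn_esup_cvg (Hl _)) -EFinM.
by rewrite sumEFin; congr EFin; exact: cvg_unique cv_l cv_theta.
Qed.

End LongRun.

(** * Optimality *)

Section ReceptionWitness.
Context {R : realType} (N : network R) {d} {T : measurableType d}
  (P : probability T R) (X : exogenous N T).
Hypothesis HX : exogenous_ok P X.
Local Notation mu := (noise_prob P X).

(** Markov's inequality: a nonzero value is at least 1, so it has probability at most [lambda]. *)
Lemma pr_zero_gt0 (a : T -> nat) (lambda : R) :
  (forall S : set nat, measurable (a @^-1` S)) ->
  'E_P[fun x => (a x)%:R]%E = lambda%:E -> lambda < 1 ->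
  0 < pr P (a @^-1` [set 0%N]).
Proof.
move=> ma Ea l1; set B := a @^-1` _.
have mB : measurable B by exact: ma.
have : (P (~` B) <= lambda%:E)%E.
  rewrite -(expectation_indic P (measurableC mB)) -Ea; apply: expectation_le => //.
  - exact: measurable_indic (measurableC mB).
  - move=> _ Y _; rewrite setTI.
    exact: (ma [set n | Y n%:R]).
  - apply: aeW => x; rewrite indicE; case: (boolP (x \in ~` B)) => // /set_mem.
    by rewrite /B /= ler1n lt0n => /eqP.
rewrite probability_setC// (prE P mB) -EFinB lee_fin; lra.
Qed.

Lemma prodr_gt0_factor (I : finType) (F : I -> R) i :
  (forall j, 0 <= F j) -> 0 < \prod_j F j -> 0 < F i.
Proof.
move=> F0 Fprod; rewrite lt0r F0 andbT.
by move: (gt_eqF Fprod) => /negbT/prodf_neq0; apply.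
Qed.

Lemma sumr_gt0_term (I : finType) (B : pred I) (F : I -> R) :
  (forall j, 0 <= F j) -> 0 < \sum_(j | B j) F j -> exists2 j, B j & 0 < F j.
Proof.
move=> F0 Fsum; apply: contrapT => noj.
move: Fsum; rewrite big1 ?ltxx// => j Bj; apply/eqP.
rewrite eq_le F0 andbT leNgt; apply/negP => Fj; apply: noj; by exists j.
Qed.

Definition no_arrival (h : fading N) : slot_noise N := (h, [ffun=> ord0], [ffun=> ord0]).

Lemma reception_witness (HN : network_ok N) k : exists h p s,
  [/\ admissible p s, 0 < mu (no_arrival h) & received h p s k].
Proof.
have [H [p [s [adm csi0 rec0]]]] := reception_possible HX k.
rewrite (csi_probE HX) lte_fin in csi0.
have [z' /eqP z'H z'0] := sumr_gt0_term (noise_prob_ge0 P X) csi0.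
have recE : reception_prob P X H p s k =
    (\sum_(z : slot_noise N | received (with_csi H z.1.1) p s k) mu z)%:E.
  rewrite -(pr_noise_pred HX) -prE//.
  exact: (measurable_finite_rv [set z : slot_noise N | received (with_csi H z.1.1) p s k]
    (@noise_rv _ _ _ _ _ _ HX 0)).
rewrite recE lte_fin in rec0.
have [z rec z0] := sumr_gt0_term (noise_prob_ge0 P X) rec0.
have fac (y : slot_noise N) j : 0 < mu y -> 0 < source_prob P X y j.
  by apply: (prodr_gt0_factor (F := source_prob P X y)) => i; exact: pr_ge0.
(* The direct links come from an outcome [z'] of positive probability with CSI [H], the other links
   from an outcome [z] under which the packet is received. Absence of arrivals has positive
   probability because the means are below 1. *)
exists (with_csi H z.1.1), p, s; split=> //.
apply: prodr_gt0 => -[[[k' b]|k']|b] _.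
- rewrite /source_prob /= ffunE /=; case: eqP => [->|_].
    have := fac _ (inl (inl (k', assoc k'))) z'0.
    by rewrite /source_prob /= -z'H ffunE.
  exact: (fac _ (inl (inl (k', b))) z0).
- apply: lt_le_trans (pr_zero_gt0 (arrQ_rv HX k' 0) (arrQ_mean HX k' 0)
    (rateQ_lt1 HN k')) _.
  rewrite -lee_fin -!prE; [|exact: (arrQ_rv HX)..].
  apply: le_measure; rewrite ?inE; [exact: (arrQ_rv HX)|exact: (arrQ_rv HX)|].
  by move=> x /= ->; rewrite ffunE; apply/val_inj; rewrite /= clipE min0n.
- apply: lt_le_trans (pr_zero_gt0 (arrE_rv HX b 0) (arrE_mean HX b 0) (rateE_lt1 HN b)) _.
  rewrite -lee_fin -!prE; [|exact: (arrE_rv HX)..].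
  apply: le_measure; rewrite ?inE; [exact: (arrE_rv HX)|exact: (arrE_rv HX)|].
  by move=> x /= ->; rewrite ffunE; apply/val_inj; rewrite /= clipE min0n.
Qed.

End ReceptionWitness.

(** * Couplings of the queues and comparison of policies *)

Section Optimality.
Context {R : realType} (N : network R) {d} {T : measurableType d}
  (P : probability T R) (X : exogenous N T).
Hypotheses (HN : network_ok N) (HX : exogenous_ok P X).
Local Notation mu := (noise_prob P X).
Local Notation mu_ge0 := (noise_prob_ge0 P X).
Local Notation mu_sum1 := (noise_prob_sum1 HX).

(* [paction N] is not a finite type; its function field becomes a finfun. *)
Notation faction := (dtx N * {ffun csi N -> sched N})%type.

Definition of_faction (a : faction) : paction N := PAction a.1 a.2.

Definition to_faction (a : paction N) : faction := (act_p a, [ffun H => act_s a H]).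

Lemma to_factionK a : of_faction (to_faction a) = a.
Proof. by case: a => p s; congr PAction; apply/funext => H /=; rewrite ffunE. Qed.

Definition feasible_factions : {set faction} :=
  [set a | `[< feasible_paction (of_faction a) >]]%SET.

Lemma feasible_factionP a :
  reflect (feasible_paction (of_faction a)) (a \in feasible_factions).
Proof. by rewrite inE; exact: asboolP. Qed.

Lemma next_energyE (E : energy N) pE (a : 'I_(nBS N) -> nat) b :
  next_energy E pE a b = minn (E b - pE b + a b) (NE N) :> nat.
Proof. by rewrite ffunE inordK// ltnS geq_minr. Qed.

Lemma next_dataE (Q : data N) h p s (a : 'I_(nMS N) -> nat) k :
  next_data Q h p s a k = minn (Q k - received h p s k + a k) (NQ N) :> nat.
Proof. by rewrite ffunE inordK// ltnS geq_minr. Qed.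

Definition more_energy_less_data (x x' : qstate N) : Prop :=
  (forall b, x'.1 b <= x.1 b)%N /\ (forall k, x.2 k <= x'.2 k)%N.

Definition less_energy_less_data (x x' : qstate N) : Prop :=
  (forall b, x.1 b <= x'.1 b)%N /\ (forall k, x.2 k <= x'.2 k)%N.

(** The missing energy, priced at one slot of grid power per unit. *)
Definition energy_gap (x x' : qstate N) : R :=
  \sum_b weightE b * ((x'.1 b)%:R - (x.1 b)%:R).

Lemma next_data_mono (Q Q' : data N) h p s a : (forall k, Q k <= Q' k)%N ->
  forall k, (next_data Q h p s a k <= next_data Q' h p s a k)%N.
Proof. by move=> QQ' k; rewrite !next_dataE; have := QQ' k; lia. Qed.

Lemma data_cost_le (Q Q' : data N) : (forall k, Q k <= Q' k)%N ->
  \sum_k weightQ k * fcost N (Q k) <= \sum_k weightQ k * fcost N (Q' k).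
Proof.
move=> QQ'; apply: ler_sum => k _; apply: ler_wpM2l; first exact/ltW/(weightQ_gt0 HN).
exact: (fcost_incr HN).
Qed.

(** Renewable-first spending preserves the order of the energy queues, and the chain with less
    energy draws grid power whenever the other one does. *)
Lemma coupling_more_energy :
  cost_coupling (fun x a z => paction_step x (of_faction a) z)
    (fun x a => stage_cost x.1 x.2 (of_faction a))
    more_energy_less_data (fun _ _ => 0).
Proof.
move=> x x' [Exx' Qxx']; split=> // a z; split.
  split; last exact: next_data_mono.
  move=> b; rewrite !next_energyE !ffunE -!val_eqE /=; have := Exx' b.
  by case: (a.1 b) => /=; lia.
rewrite !addr0; apply: lerD; first exact: data_cost_le.
apply: ler_sum => b _; apply: ler_wpM2l.
  by rewrite mulr_ge0// ltW// (weightE_gt0 HN).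
by rewrite ler_nat -!val_eqE /=; have := Exx' b; lia.
Qed.

(* A unit of stored energy is worth at most one slot of grid power. *)
Lemma coupling_less_energy :
  cost_coupling (fun x a z => paction_step x (of_faction a) z)
    (fun x a => stage_cost x.1 x.2 (of_faction a))
    less_energy_less_data energy_gap.
Proof.
move=> x x' [Exx' Qxx']; split=> [|a z].
  apply: sumr_ge0 => b _; rewrite mulr_ge0//; first exact/ltW/(weightE_gt0 HN).
  by rewrite subr_ge0 ler_nat.
split.
  split; last exact: next_data_mono.
  move=> b; rewrite !next_energyE !ffunE -!val_eqE /=; have := Exx' b.
  by case: (a.1 b) => /=; lia.
rewrite /stage_cost -!addrA; apply: lerD; first exact: data_cost_le.
rewrite /energy_gap -!big_split; apply: ler_sum => b _ /=.
rewrite -!mulrA -!mulrDr; apply: ler_wpM2l; first exact/ltW/(weightE_gt0 HN).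
set n' := next_energy _ _ _ b; set n := next_energy _ _ _ b.
have : (a.1 b * (x.1 b == ord0) + n' + x.1 b <= a.1 b * (x'.1 b == ord0) + x'.1 b + n)%N.
  rewrite /n /n' !next_energyE !ffunE -!val_eqE /=.
  have := Exx' b; have := ltn_ord (x'.1 b); rewrite ltnS.
  by case: (a.1 b) => /=; lia.
by rewrite -(ler_nat R) !natrD !natrM; lra.
Qed.

(** Keep the actions of the policy but split the power renewable-first. This leaves at most as much
    energy and the same data, so the continuation value rises by at most the price of the additional
    energy spent, which is exactly the cost of the grid power saved. *)
Lemma renewable_first_le (V : qstate N -> R) (theta : R) (pi : policy N) t s :
  feasible pi ->
  (forall x x', less_energy_less_data x x' -> V x <= V x' + energy_gap x x') ->
  (forall x a, feasible_paction a ->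
     theta + V x <= stage_cost x.1 x.2 a + avg mu (fun z => V (paction_step x a z))) ->
  theta + V s <= slot_cost pi t s + avg mu (fun z => V (policy_step pi t s z)).
Proof.
move=> feas Vgap Vbell.
pose a := PAction (pol_p pi t s.1 s.2) (pol_s pi t s.1 s.2).
have [_ _ pE0 pEG adm] := feas t s.1 s.2.
set pE := pol_pE pi t s.1 s.2 in pE0 pEG; set pG := pol_pG pi t s.1 s.2 in pEG.
have pE_gt0 b : pE b -> (0 < s.1 b)%N.
  move=> pb; rewrite lt0n; apply/negP => /eqP s0.
  by move: pb; rewrite pE0//; exact: val_inj.
apply: (le_trans (Vbell s a adm)).
pose D := \sum_b weightE b * ((renewable_part s.1 (act_p a) b)%:R - (pE b)%:R) : R.
have VD : avg mu (fun z => V (paction_step s a z)) <=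
    avg mu (fun z => V (policy_step pi t s z)) + D.
  rewrite -[D](avg_cst mu_sum1) -avgD; apply: (le_avg mu_ge0) => z.
  have step_le b : ((paction_step s a z).1 b <= (policy_step pi t s z).1 b)%N /\
      ((policy_step pi t s z).1 b + pE b <=
       (paction_step s a z).1 b + renewable_part s.1 (act_p a) b)%N.
    rewrite !next_energyE !ffunE -/pE -/pG -val_eqE /=.
    have := ltn_ord (s.1 b); rewrite ltnS; have := pEG b; have := pE_gt0 b.
    by case: (pE b) (pG b) => -[] /=; lia.
  apply: (le_trans (Vgap _ (policy_step pi t s z) _)).
    by split=> [b|k //]; have [] := step_le b.
  rewrite lerD2l; apply: ler_sum => b _.
  apply: ler_wpM2l; first exact/ltW/(weightE_gt0 HN).
  by have [_] := step_le b; rewrite -(ler_nat R) !natrD; lra.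
have costE : stage_cost s.1 s.2 a + D = slot_cost pi t s.
  rewrite /slot_cost big_sumType /stage_cost -addrA; congr (_ + _).
  rewrite -big_split; apply: eq_bigr => b _ /=.
  rewrite -mulrA -mulrDr; congr (_ * _); rewrite !ffunE -/pE -/pG -!val_eqE /=.
  have := pEG b; have := pE_gt0 b; rewrite lt0n.
  case: (pE b) (pG b) => -[] /=; rewrite ?andbT; case: (_ == _) => //= h;
    rewrite ?h//; lra.
by move: VD; rewrite -costE; lra.
Qed.

(** Use the reception witness of a user with a nonempty queue: its noise has no arrivals, so that
    queue shrinks and no other grows. *)
Lemma paction_reduces_backlog (x : qstate N) : (0 < \sum_k x.2 k)%N ->
  exists a z, [/\ a \in feasible_factions, 0 < mu z &
    (\sum_k (paction_step x (of_faction a) z).2 k < \sum_k x.2 k)%N].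
Proof.
rewrite lt0n sum_nat_eq0 => /forallPn[k]; rewrite implyTb -lt0n => xk.
have [h [p [s [adm mu0 rec]]]] := reception_witness HX HN k.
exists (p, [ffun=> s]), (no_arrival h); split=> //.
  by apply/feasible_factionP => H; rewrite /= ffunE.
have nextE k' : (paction_step x (of_faction (p, [ffun=> s])) (no_arrival h)).2 k' =
    (x.2 k' - received h p s k')%N :> nat.
  rewrite next_dataE /= !ffunE addn0; apply/minn_idPl.
  by rewrite leq_subLR; have := ltn_ord (x.2 k'); rewrite ltnS; lia.
rewrite (bigD1 k) //= [X in (_ < X)%N](bigD1 k) //= -addSn leq_add//.
  by rewrite nextE rec; lia.
by apply: leq_sum => k' _; rewrite nextE leq_subr.
Qed.

Definition empty_state : qstate N := ([ffun=> ord0], [ffun=> ord0]).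

Lemma feasible_paction_exists : exists a : faction, a \in feasible_factions.
Proof.
have [H [p [s [adm _ _]]]] := reception_possible HX (Ordinal (nMS_gt0 HN)).
by exists (p, [ffun=> s]); apply/feasible_factionP => H'; rewrite /= ffunE.
Qed.

Lemma qvalue_bellman_rhs (V : qstate N -> R) x a :
  qvalue mu (fun x a z => paction_step x (of_faction a) z)
    (fun x a => stage_cost x.1 x.2 (of_faction a)) 1 V x a =
  bellman_rhs P X (fun E Q => V (E, Q)) x.1 x.2 (of_faction a).
Proof.
by rewrite (bellman_rhsE HX) /qvalue mul1r.
Qed.

Lemma bellman_solution : exists (theta : R) (V : qstate N -> R),
  bellman P X theta (fun E Q => V (E, Q)) /\
  forall x x', less_energy_less_data x x' -> V x <= V x' + energy_gap x x'.
Proof.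
have [a0 Fa0] := feasible_paction_exists.
have L1 (x : qstate N) : (\sum_k x.2 k)%N = 0%N -> more_energy_less_data x empty_state.
  move=> /eqP; rewrite sum_nat_eq0 => /forallP x0.
  by split=> i; rewrite /= ffunE// leqn0; have := x0 i; rewrite implyTb.
have L2 x : less_energy_less_data empty_state x by split=> i; rewrite /= ffunE.
have [theta [V [Vle Vex Vgap]]] := average_cost_bellman mu_ge0 mu_sum1 Fa0
  coupling_more_energy coupling_less_energy L1 L2 paction_reduces_backlog.
exists theta, V; split=> // E Q; split.
  have [a /feasible_factionP aF aE] := Vex (E, Q).
  by exists (of_faction a) => //; rewrite aE qvalue_bellman_rhs.
move=> a aF; have := Vle (E, Q) (to_faction a).
rewrite qvalue_bellman_rhs to_factionK; apply.
by apply/feasible_factionP; rewrite to_factionK.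
Qed.

Lemma component_weight_ge0 i : 0 <= @component_weight R N i.
Proof.
by case: i => [k|b]; apply: ltW; [exact: weightQ_gt0 | exact: weightE_gt0].
Qed.

Lemma bellman_rhs_step (V : energy N -> data N -> R) x a :
  bellman_rhs P X V x.1 x.2 a =
  stage_cost x.1 x.2 a + avg mu (fun z => (fun y => V y.1 y.2) (paction_step x a z)).
Proof. by rewrite (bellman_rhsE HX) -surjective_pairing. Qed.

Lemma stationary_p (Om : energy N -> data N -> paction N) t E Q :
  pol_p (stationary Om) t E Q = act_p (Om E Q).
Proof. by apply/ffunP => b; rewrite !ffunE; case: (act_p _ b); case: eqP. Qed.

Lemma stationary_step (Om : energy N -> data N -> paction N) t x z :
  policy_step (stationary Om) t x z = paction_step x (Om x.1 x.2) z.
Proof. by rewrite /policy_step stationary_p. Qed.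

Lemma stationary_avg (Om : energy N -> data N -> paction N) t x (F : qstate N -> R) :
  avg mu (fun z => F (policy_step (stationary Om) t x z)) =
  avg mu (fun z => F (paction_step x (Om x.1 x.2) z)).
Proof. by apply: eq_bigr => z _; rewrite stationary_step. Qed.

Lemma stationary_cost (Om : energy N -> data N -> paction N) t x :
  slot_cost (stationary Om) t x = stage_cost x.1 x.2 (Om x.1 x.2).
Proof.
rewrite /slot_cost big_sumType; congr (_ + _); apply: eq_bigr => b _ /=.
by rewrite ffunE -mulrA -natrM mulnb.
Qed.

Lemma stationary_feasible (H0 : csi N) (Om : energy N -> data N -> paction N) :
  (forall E Q, feasible_paction (Om E Q)) -> feasible (stationary Om).
Proof.
move=> OmF t E Q.
have [pA _ _] := OmF E Q H0; have [rE rG] := renewable_first_ok HN E pA.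
split=> //= [b Eb|b|H]; last by rewrite stationary_p; exact: OmF.
  by rewrite ffunE Eb eqxx andbF.
by rewrite !ffunE; case: (act_p _ b); case: eqP.
Qed.

Lemma stationary_average_cost theta V Om x1 H1 :
  bellman P X theta V -> attains_minimum P X V Om ->
  average_cost P X (stationary Om) x1 H1 = theta%:E.
Proof.
move=> bell Omin.
apply: (@average_cost_eq _ _ _ _ _ _ HX _ _ _ _ (fun y => V y.1 y.2))
  => [t s z|t [k|b] s //|t s].
  by rewrite !stationary_step.
rewrite stationary_cost (stationary_avg Om _ s (fun y => V y.1 y.2)).
rewrite -bellman_rhs_step; have [[a aF aE] lo] := bell s.1 s.2.
have [OmF Ole] := Omin s.1 s.2.
by apply/eqP; rewrite eq_le lo//= -aE Ole.
Qed.

(** An arbitrary solution comes without the gap inequality, so only renewable-first stationary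
    policies are bounded here; this suffices to compare two solutions. *)
Lemma stationary_average_cost_ge theta V Om x1 H1 :
  bellman P X theta V -> (forall E Q, feasible_paction (Om E Q)) ->
  (theta%:E <= average_cost P X (stationary Om) x1 H1)%E.
Proof.
move=> bell OmF.
apply: (@average_cost_ge _ _ _ _ _ _ HX _ _ _ _ (fun y => V y.1 y.2)
  component_weight_ge0) => t s.
rewrite stationary_cost (stationary_avg Om _ s (fun y => V y.1 y.2)).
by rewrite -bellman_rhs_step; have [_] := bell s.1 s.2; apply; exact: OmF.
Qed.

Lemma bellman_attained theta V : bellman P X theta V ->
  exists Om, attains_minimum P X V Om.
Proof.
move=> bell.
have [Om HOm] : {Om : qstate N -> paction N & forall x, feasible_paction (Om x) /\
    bellman_rhs P X V x.1 x.2 (Om x) = theta + V x.1 x.2}.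
  apply: (choice (P := fun x (a : paction N) => feasible_paction a /\
    bellman_rhs P X V x.1 x.2 a = theta + V x.1 x.2)) => x.
  by have [[a aF aE] _] := bell x.1 x.2; exists a.
exists (fun E Q => Om (E, Q)) => E Q.
have [OmF OmE] := HOm (E, Q); split; first exact: OmF.
move=> a aF; rewrite [X in X <= _]OmE.
by have [_] := bell E Q; apply.
Qed.

(** [renewable_first_le] turns the Bellman inequality for renewable-first actions into one for the
    actual steps and costs of [pi], to which the telescoping bound applies. *)
Lemma optimal_cost_le theta pi x1 H1 : feasible pi ->
  (exists2 V : qstate N -> R, bellman P X theta (fun E Q => V (E, Q)) &
   forall x x', less_energy_less_data x x' -> V x <= V x' + energy_gap x x') ->
  (theta%:E <= average_cost P X pi x1 H1)%E.
Proof.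
move=> feas [V bell Vgap].
apply: (@average_cost_ge _ _ _ _ _ _ HX _ _ _ _ V component_weight_ge0) => t s.
apply: renewable_first_le => // x a aF.
have [_ /(_ a aF)] := bell x.1 x.2; rewrite bellman_rhs_step -surjective_pairing.
by rewrite /avg; under eq_bigr do rewrite -surjective_pairing.
Qed.

End Optimality.

Theorem lemma2 (R : realType) (N : network R) (d : measure_display)
    (T : measurableType d) (P : probability T R) (X : exogenous N T)
    (HN : network_ok N) (HX : exogenous_ok P X) :
  (exists (theta : R) (V : energy N -> data N -> R), bellman P X theta V) /\
  (forall (theta : R) (V : energy N -> data N -> R), bellman P X theta V ->
     (forall (E : energy N) (Q : data N) (H : csi N),
        is_minimum [set pi : policy N | feasible pi]%classic
          (fun pi => average_cost P X pi (E, Q) H) (theta%:E)%E) /\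
     (forall Om : energy N -> data N -> paction N,
        attains_minimum P X V Om -> optimal P X (stationary Om))).
Proof.
have [theta0 [V0 [bell0 V0gap]]] := bellman_solution HN HX.
split; first by exists theta0, (fun E Q => V0 (E, Q)).
move=> theta V bell.
have [Om0 Om0min] := bellman_attained bell0.
have [Om1 Om1min] := bellman_attained bell.
have OmF V' Om : attains_minimum P X V' Om -> forall E Q, feasible_paction (Om E Q).
  by move=> Omin E Q; have [] := Omin E Q.
have lower pi x1 H1 : feasible pi -> (theta0%:E <= average_cost P X pi x1 H1)%E.
  by move=> pi_feas; apply: (optimal_cost_le HN HX) => //; exists V0.
(* Feasibility of a partitioned action is quantified over the CSI, so some value is needed to
   extract its power constraint. *)
have H0 : csi N := csi_of (fading_at X 0 point).
have feas (Om : energy N -> data N -> paction N) :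
    (forall E Q, feasible_paction (Om E Q)) -> feasible (stationary Om).
  exact: (stationary_feasible HN H0).
(* Each value is the cost of a minimising stationary policy of its own solution, and a lower bound
   for the cost of the other one's. *)
have thetaE : theta = theta0.
  pose x1 := empty_state N.
  apply/eqP; rewrite eq_le -!lee_fin; apply/andP; split.
    rewrite -(stationary_average_cost HX x1 H0 bell0 Om0min).
    by apply: (stationary_average_cost_ge HN HX) => //; exact: (OmF _ _ Om0min).
  rewrite -(stationary_average_cost HX x1 H0 bell Om1min).
  by apply/lower/feas; exact: (OmF _ _ Om1min).
split=> [E Q H|Om Omin].
  split; last by move=> pi pi_feas; rewrite thetaE; exact: lower.
  exists (stationary Om1); first by apply: feas; exact: (OmF _ _ Om1min).
  exact: (stationary_average_cost HX).
split; first by apply: feas; exact: (OmF _ _ Omin).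
move=> pi x1 H1 pi_feas.
by rewrite (stationary_average_cost HX x1 H1 bell Omin) thetaE; exact: lower.
Qed.
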